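(* Let $n\ge 19$ and let $\nu$ be a $4^{-n^2}$-approximate unitary $\frac{n}{10\log_2 n}$-design on dimension $2^n$. Let $d=2^n=d_Sd_E$ with $2\le d_S\le 2^{n/10}$, and let $\alpha\ge 2$. Let $\rho_0$ be any fixed state on $\mathcal{H}_S\otimes\mathcal{H}_E$, where $\dim\mathcal{H}_S=d_S$ and $\dim\mathcal{H}_E=d_E$, and for $U\in\mathcal{U}(d)$ let $\psi=U\rho_0U^\dagger$ and $\psi_S=\operatorname{tr}_E\psi$. Then $$\mathbb{P}_\nu\left(S(\psi_S)\le\log_2 d_S-\alpha-\beta\right)\le 8\cdot 2^{-\frac{n}{80\log_2 n}\left(\frac{n}{5}+\alpha\right)},$$ where $\beta=\frac{1}{\ln 2}\frac{d_S}{d_E}$.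
   Context: A state is a density matrix (positive semidefinite with trace $1$). $S(\sigma)=-\operatorname{tr}(\sigma\log_2\sigma)$ is the von Neumann entropy. $\operatorname{tr}_E$ is the partial trace over $\mathcal{H}_E$. $\mathcal{U}(d)$ is the group of $d\times d$ unitary matrices acting on $\mathcal{H}_S\otimes\mathcal{H}_E$. $\mathbb{E}_H$ is expectation for $U$ Haar distributed on $\mathcal{U}(d)$; $\mathbb{P}_\nu,\mathbb{E}_\nu$ are probability and expectation for $U$ drawn from $\nu$. A balanced monomial of degree $j$ in the elements of $U$ is a product of $j$ matrix elements of $U$ and $j$ complex conjugates of matrix elements of $U$. A probability distribution $\nu$ on $\mathcal{U}(d)$ is an $\epsilon$-approximate unitary $k$-design (on dimension $d$) if for all balanced monomials $M$ of degree $\le k$, $|\mathbb{E}_\nu M(U)-\mathbb{E}_H M(U)|\le\epsilon/d^k$. Here this is used with $k=\frac{n}{10\log_2 n}$ and $\epsilon=4^{-n^2}$.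
   Formalization: The design order n/(10 log_2 n), which is never an integer, is rounded up to the next integer k (degrees at most k, tolerance 4^{-n^2}/d^k); testing only degrees up to the rounded-down order makes the claim false, e.g. Pauli matrices with n=100, d_S=2^10, alpha=2. *)

(* Defs.v *)
From HB Require Import structures.
From mathcomp Require Import all_boot all_order all_algebra.
From mathcomp Require Import all_classical all_reals all_analysis.
From mathcomp Require Import complex mxtens.

Set Implicit Arguments.
Unset Strict Implicit.
Unset Printing Implicit Defensive.

Import Order.TTheory GRing.Theory Num.Theory.
Local Open Scope classical_set_scope.
Local Open Scope ring_scope.
Local Open Scope sesquilinear_scope.
Local Open Scope complex_scope.

Definition log2 (R : realType) (x : R) : R := ln x / ln 2.

Section Unitary.
Context (R : realType) (d : nat).

Definition unitary := {U : 'M[R[i]]_d | U \is unitarymx}.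

HB.instance Definition _ := Choice.on unitary.

Fact unitary1_subproof : (1%:M : 'M[R[i]]_d) \is unitarymx.
Proof. by apply/unitarymxP; rewrite trmx1 map_mx1 mulmx1. Qed.

HB.instance Definition _ :=
  isPointed.Build unitary (exist _ 1%:M unitary1_subproof).

Definition unitary_mul (V U : unitary) : unitary :=
  exist _ (val V *m val U) (mul_unitarymx (valP V) (valP U)).

(* [unitary] is second countable for the topology induced by the entries, so
   the sigma-algebra generated by the real and imaginary parts of the entries
   is the Borel sigma-algebra. *)
Definition unitary_entry_sets : set (set unitary) :=
  [set A | exists i j (B : set R), measurable B /\
    (A = (fun U : unitary => complex.Re (val U i j)) @^-1` B \/
     A = (fun U : unitary => complex.Im (val U i j)) @^-1` B)].

(* The unitary group as a measurable space. *)
Definition unitaryGroup := g_sigma_algebraType unitary_entry_sets.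

(* For a probability measure on a compact group, left invariance already
   characterizes the Haar measure (right invariance follows). *)
Definition is_haar (H : probability unitaryGroup R) : Prop :=
  forall (V : unitary) (A : set unitaryGroup), measurable A ->
    H [set U | A (unitary_mul V U)] = H A.

Definition balanced_monomial (j : nat) (p q : 'I_j -> 'I_d * 'I_d)
    (U : unitaryGroup) : R[i] :=
  (\prod_(l < j) (val U) (p l).1 (p l).2) *
  (\prod_(l < j) ((val U) (q l).1 (q l).2)^*).

(* The library's expectation is extended-real valued and only defined for
   real random variables; [f] must have integrable real and imaginary parts. *)
Definition cexpectation (P : probability unitaryGroup R)
    (f : unitaryGroup -> R[i]) : R[i] :=
  fine 'E_P[fun U => complex.Re (f U)] +i*
  fine 'E_P[fun U => complex.Im (f U)].

(* [H] is meant to be the Haar probability measure. *)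
Definition approx_unitary_design (H nu : probability unitaryGroup R)
    (eps : R) (k : nat) : Prop :=
  forall (j : nat) (p q : 'I_j -> 'I_d * 'I_d), (j <= k)%N ->
    `| cexpectation nu (balanced_monomial p q)
       - cexpectation H (balanced_monomial p q) | <= (eps / d%:R ^+ k)%:C.

End Unitary.

Section States.
Context (R : realType).

Definition psdmx (n : nat) (A : 'M[R[i]]_n) : Prop :=
  A \is hermsymmx /\ forall v : 'rV[R[i]]_n, 0 <= (v *m A *m v ^t*) 0 0.

Definition is_state (n : nat) (rho : 'M[R[i]]_n) : Prop :=
  psdmx rho /\ \tr rho = 1.

Definition conj_unitary (n : nat) (U : unitaryGroup R n) (rho : 'M[R[i]]_n)
    : 'M[R[i]]_n :=
  val U *m rho *m (val U) ^t*.

(* The basis vector e_s (x) e_e of C^dS (x) C^dE has index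
   [mxtens_index (s, e)], as for the Kronecker product [tensmx]. *)
Definition ptraceE (dS dE : nat) (A : 'M[R[i]]_(dS * dE)) : 'M[R[i]]_dS :=
  \matrix_(s, t) \sum_(e < dE) A (mxtens_index (s, e)) (mxtens_index (t, e)).

(* Functional calculus for a Hermitian [A], whose eigenvalues
   [spectral_diag A] are real: A = P^-1 diag(lambda) P is sent to
   P^-1 diag(f lambda) P. *)
Definition herm_fun (f : R -> R) (n : nat) (A : 'M[R[i]]_n) : 'M[R[i]]_n :=
  invmx (spectralmx A)
  *m diag_mx (map_mx (fun z => (f (complex.Re z))%:C) (spectral_diag A))
  *m spectralmx A.

(* As [ln 0 = 0] in the library, a zero eigenvalue contributes 0, which is the
   usual convention 0 log 0 = 0. *)
Definition vn_entropy (n : nat) (sigma : 'M[R[i]]_n) : R :=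
  - complex.Re (\tr (sigma *m herm_fun (@log2 R) sigma)).

End States.

(* Main.v *)
(* Idea: put Z = psi_S and X = d_S tr(Z^2) - 1 = d_S |Z - 1/d_S|_2^2 >= 0.
   Since S(Z) >= - log2 tr(Z^2), the event forces X >= 2^alpha - 1.  X is a
   balanced polynomial of degree 2 in the entries of U, so the m-th moment of X,
   m = k/2, is the same under the design as under the Haar measure, up to a
   negligible error, and Markov's inequality concludes.  For n <= 63 either the
   right-hand side is at least 1 or the event is empty.

   Instead of Levy's lemma, the Haar moments are bounded by symmetrization: the
   Haar measure is invariant under left multiplication by sign matrices, so that
   Khintchine's inequality applies.  Composing with a unitary matrix with a flat
   row bounds the entries of U; signs on one block bound the off-diagonal entries
   of Z; and a rotation mixing two basis vectors of H_S turns a difference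
   Z_ss - Z_tt into i (Z_st - Z_ts). *)

Require Import Defs.
From HB Require Import structures.
From mathcomp Require Import all_boot all_order all_algebra.
From mathcomp Require Import all_classical all_reals all_analysis.
From mathcomp Require Import measurable_realfun complex mxtens ring lra zify.

Set Implicit Arguments.
Unset Strict Implicit.
Unset Printing Implicit Defensive.

Import Order.TTheory GRing.Theory Num.Theory.
Import numFieldNormedType.Exports.
Local Open Scope classical_set_scope.
Local Open Scope ring_scope.
Local Open Scope sesquilinear_scope.
Local Open Scope complex_scope.

(** * Power means and Khintchine's inequality *)

(** A design controls only balanced polynomials, so the entropy is traded for the purity. Each
    symmetrization answers an obstacle. A sign matrix alone leaves [|U i k|] unchanged, so a unitary
    with a flat row is applied after it and turns an entry into a signed sum over a column of norm
    1. Conjugation by signs fixes the diagonal of [Z], so diagonal entries need a rotation instead.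
    Only left translations occur: the eigenvectors of [rho] enter as a fixed right factor.

    The constants grow like [m^(6m)]; with [16 m <= n] and [n <= 2^(n/10)] they cost at most
    [2^(3nm/5)], while [d_S^(2m)] costs [2^(nm/5)]. Against the denominator [d^m = 2^(nm)] this
    leaves [2^(-nm/5)], the origin of [n/5] in the exponent. Small [n] is treated apart because, as
    long as [log2 n >= n/10], the design has order 1 and controls no polynomial of degree 2. *)

Section PowerMean.
Context (R : realFieldType).

(** Convexity of the power: in the induction, [y] times one tangent exceeds the next tangent by a
    multiple of [(y - a) ^+ 2]. At [a = 1] this is Bernoulli's inequality. *)
Lemma exprn_tangent (a y : R) n : 0 <= a -> 0 <= y ->
  a ^+ n + n%:R * a ^+ n.-1 * (y - a) <= y ^+ n.
Proof.
move=> a0 y0; elim: n => [|[|n] IHn]; first by rewrite !expr0 mul0r mul0r addr0.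
  by rewrite !expr1 expr0 !mul1r addrC subrK.
rewrite [leRHS]exprS; apply: le_trans (ler_wpM2l y0 IHn).
rewrite /= -subr_ge0.
have -> : y * (a ^+ n.+1 + n.+1%:R * a ^+ n * (y - a)) -
  (a ^+ n.+2 + n.+2%:R * a ^+ n.+1 * (y - a)) = n.+1%:R * a ^+ n * (y - a) ^+ 2.
  by rewrite !exprS -(natr1 n.+1); ring.
by rewrite mulr_ge0 ?sqr_ge0// mulr_ge0 ?exprn_ge0.
Qed.

(** The tangent inequality at the weighted mean [a], averaged: the linear terms cancel. *)
Lemma jensen_exprn (I : finType) (w y : I -> R) n :
  (forall i, 0 <= w i) -> \sum_i w i = 1 -> (forall i, 0 <= y i) ->
  (\sum_i w i * y i) ^+ n <= \sum_i w i * y i ^+ n.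
Proof.
move=> w0 w1 y0; set a := \sum_i w i * y i.
have a0 : 0 <= a by apply: sumr_ge0 => i _; exact: mulr_ge0.
have /(ler_sum (index_enum I)): forall i, true ->
    w i * (a ^+ n + n%:R * a ^+ n.-1 * (y i - a)) <= w i * y i ^+ n.
  by move=> i _; rewrite ler_wpM2l// exprn_tangent.
apply: le_trans.
under eq_bigr do rewrite mulrDr mulrCA mulrBr.
rewrite big_split/= -mulr_sumr -mulr_suml w1 sumrB -!mulr_suml w1 !mul1r.
by rewrite subrr mulr0 addr0.
Qed.

Lemma sum_exprn_le (I : finType) (y : I -> R) n : (0 < n)%N ->
  (forall i, 0 <= y i) ->
  (\sum_i y i) ^+ n <= #|I|%:R ^+ n.-1 * \sum_i y i ^+ n.
Proof.
case: n => // n _ y0; have [I0|I0] := posnP #|I|.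
  have e (f : I -> R) : \sum_i f i = 0.
    by rewrite big1// => i; have := fintype0 i; rewrite I0.
  by rewrite !e mulr0 expr0n.
have N0 : #|I|%:R != 0 :> R by rewrite pnatr_eq0 -lt0n.
have w1 : \sum_(i : I) #|I|%:R^-1 = 1 :> R.
  by rewrite sumr_const -[LHS]mulr_natl mulfV.
have w0 (i : I) : 0 <= #|I|%:R^-1 :> R by rewrite invr_ge0.
have N1 : (0 : R) <= #|I|%:R ^+ n.+1 by rewrite exprn_ge0.
move: (ler_wpM2l N1 (jensen_exprn n.+1 w0 w1 y0)).
rewrite -!mulr_sumr exprMn !mulrA -exprMn mulfV// expr1n mul1r.
by rewrite [#|I|%:R ^+ n.+1]exprSr -(mulrA (_ ^+ n)) mulfV// mulr1.
Qed.

End PowerMean.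

Section Khintchine.
Context (R : realFieldType) (I : finType).

Definition flip (i : I) (e : {ffun I -> bool}) : {ffun I -> bool} :=
  [ffun j => e j (+) (j == i)].

Lemma flipK i : involutive (flip i).
Proof. by move=> e; apply/ffunP => j; rewrite !ffunE addbK. Qed.

Lemma sum_flip (i : I) (F : {ffun I -> bool} -> R) :
  \sum_e F e = \sum_e (F e + F (flip i e)) / 2.
Proof.
rewrite -mulr_suml big_split/=; have <- : \sum_e F e = \sum_e F (flip i e).
  by rewrite (reindex_inj (inv_inj (flipK i))).
by field.
Qed.

Definition sgn (b : bool) : R := (-1) ^+ b.

(** For even [n] the signs disappear and the larger of [|x|], [|y|] dominates. This bounds each term
    in the factorization of a difference of odd powers. *)
Lemma exprM_even_le (x y : R) n i : ~~ odd n -> (i <= n)%N ->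
  x ^+ (n - i) * y ^+ i <= x ^+ n + y ^+ n.
Proof.
move=> en ile; have np (z : R) : z ^+ n = `|z| ^+ n.
  by rewrite -normrX ger0_norm// exprn_even_ge0.
rewrite (np x) (np y); apply: le_trans (ler_norm _) _; rewrite normrM !normrX.
have [xy|/ltW yx] := leP `|x| `|y|.
  apply: (@le_trans _ _ (`|y| ^+ n)); last by rewrite lerDr exprn_ge0.
  by rewrite -{2}(subnK ile) exprD ler_wpM2r ?exprn_ge0// lerXn2r ?nnegrE.
apply: (@le_trans _ _ (`|x| ^+ n)); last by rewrite lerDl exprn_ge0.
by rewrite -{2}(subnK ile) exprD ler_wpM2l ?exprn_ge0// lerXn2r ?nnegrE.
Qed.

Definition ssum (a : I -> R) (e : {ffun I -> bool}) := \sum_i sgn (e i) * a i.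

Lemma ssum_flip a i e : ssum a (flip i e) = ssum a e - 2 * (sgn (e i) * a i).
Proof.
rewrite /ssum (bigD1 i)//= [X in _ = X - _](bigD1 i)//= !ffunE eqxx addbT.
rewrite (eq_bigr (fun j => sgn (e j) * a j)); last first.
  by move=> j /negPf ji; rewrite ffunE ji addbF.
by rewrite /sgn; case: (e i); rewrite /= ?expr0 ?expr1; ring.
Qed.

(* Flipping [e i] changes [ssum a e] by [2 * sgn (e i) * a i], so averaging over
   the flip gains a factor [a i]; this gives an induction on [q]. *)
Lemma khintchine_step (a : I -> R) i q :
  \sum_(e : {ffun I -> bool}) sgn (e i) * a i * ssum a e ^+ (2 * q).+1 <=
  2 * (2 * q).+1%:R * a i ^+ 2 * \sum_e ssum a e ^+ (2 * q).
Proof.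
rewrite [leLHS](sum_flip i) [in leRHS](sum_flip i) mulr_sumr.
apply: ler_sum => e _; set b := sgn (e i) * a i.
have -> : sgn (flip i e i) * a i = - b.
  by rewrite ffunE eqxx addbT /b /sgn; case: (e i); rewrite ?expr0 ?expr1; ring.
have ab : a i ^+ 2 = b ^+ 2.
  by rewrite /b exprMn /sgn sqrr_sign mul1r.
set x := ssum a e; set y := ssum a _.
have xy : x - y = 2 * b by rewrite /y ssum_flip -/b -/x; ring.
(* [subrXX] extracts [x - y = 2 * b] from the difference of odd powers, so that the prefactor
   becomes [2 * b ^+ 2]. *)
rewrite mulrA ler_wpM2r ?invr_ge0// mulNr -mulrBr subrXX xy ab.
have /(ler_sum (index_enum 'I_(2 * q).+1)) : forall j : 'I_(2 * q).+1, true ->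
    x ^+ ((2 * q).+1.-1 - j) * y ^+ j <= x ^+ (2 * q) + y ^+ (2 * q).
  move=> j _; apply: exprM_even_le; first by rewrite mul2n odd_double.
  by rewrite -ltnS ltn_ord.
rewrite sumr_const card_ord -[_ *+ (2 * q).+1]mulr_natl => h.
have b0 : 0 <= 2 * b ^+ 2 by rewrite mulr_ge0 ?sqr_ge0.
rewrite [leLHS](_ : _ = 2 * b ^+ 2 * \sum_(j < (2 * q).+1) x ^+ (2 * q - j) * y ^+ j).
  rewrite [leRHS](_ : _ = 2 * b ^+ 2 *
    ((2 * q).+1%:R * (x ^+ (2 * q) + y ^+ (2 * q)))); last by ring.
  exact: ler_wpM2l.
by rewrite [LHS]mulrA expr2 (mulrCA b).
Qed.

(** Splitting off one factor, [S^(2q+2)] is the sum of [sgn (e i) * a i * S^(2q+1)]. The constant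
    [c_q = (2q)!] is cruder than [(2q-1)!!], but satisfies the recurrence [2 (2q+1) c_q <= c_(q+1)]
    that [khintchine_step] asks for. *)
Lemma khintchine_real (a : I -> R) q :
  \sum_e ssum a e ^+ (2 * q) <=
  #|{ffun I -> bool}|%:R * (2 * q)`!%:R * (\sum_i a i ^+ 2) ^+ q.
Proof.
elim: q => [|q IHq].
  by rewrite muln0 fact0 !mulr1 (eq_bigr (fun=> 1)) ?sumr_const// => e _.
set s2 := \sum_i a i ^+ 2.
have s20 : 0 <= s2 by apply: sumr_ge0 => i _; exact: sqr_ge0.
have -> : \sum_e ssum a e ^+ (2 * q.+1) =
    \sum_i \sum_(e : {ffun I -> bool}) sgn (e i) * a i * ssum a e ^+ (2 * q).+1.
  rewrite exchange_big/=; apply: eq_bigr => e _.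
  by rewrite -mulr_suml -/(ssum a e) -exprS mulnS.
apply: le_trans (ler_sum _ (fun i _ => khintchine_step a i q)) _.
rewrite -mulr_suml -mulr_sumr -/s2.
have c0 : 0 <= 2 * (2 * q).+1%:R * s2 by rewrite !mulr_ge0.
apply: le_trans (ler_wpM2l c0 IHq) _.
rewrite [_ ^+ q.+1]exprS.
set N := #|_|%:R; set F : R := _`!%:R.
have -> : 2 * (2 * q).+1%:R * s2 * (N * F * s2 ^+ q) =
  N * (2 * (2 * q).+1%:R * F) * (s2 * s2 ^+ q) by ring.
rewrite ler_wpM2r ?mulr_ge0 ?exprn_ge0// ler_wpM2l ?ler0n//.
rewrite /F -!natrM ler_nat [(2 * q.+1)%N]mulnS !add2n factS [((2 * q).+1)`!]factS mulnA.
by rewrite leq_mul2r leq_mul2r ltnS; apply/orP; right; apply/orP; right; lia.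
Qed.

End Khintchine.

(** * Squared moduli and Khintchine's inequality for complex coefficients *)

Section SquaredModulus.
Context (R : rcfType).
Implicit Types (x y z : R[i]).

Lemma conjCE z : Num.conj z = z^*%C.
Proof. by []. Qed.

Lemma conjcB x y : (x - y)^*%C = x^*%C - y^*%C.
Proof. exact: (rmorphB (@conjc R)). Qed.

Lemma conjcM x y : (x * y)^*%C = x^*%C * y^*%C.
Proof. exact: (rmorphM (@conjc R)). Qed.

Lemma conjc_sum (I : Type) (r : seq I) (P : pred I) (F : I -> R[i]) :
  (\sum_(i <- r | P i) F i)^*%C = \sum_(i <- r | P i) (F i)^*%C.
Proof. exact: (rmorph_sum (@conjc R)). Qed.

Lemma conjc_prod (I : Type) (r : seq I) (P : pred I) (F : I -> R[i]) :
  (\prod_(i <- r | P i) F i)^*%C = \prod_(i <- r | P i) (F i)^*%C.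
Proof. exact: (rmorph_prod (@conjc R)). Qed.

Lemma ReD x y : complex.Re (x + y) = complex.Re x + complex.Re y.
Proof. by case: x y => [a b] [c d]. Qed.

Lemma ImD x y : complex.Im (x + y) = complex.Im x + complex.Im y.
Proof. by case: x y => [a b] [c d]. Qed.

Lemma Re_sum (I : Type) (r : seq I) (P : pred I) (F : I -> R[i]) :
  complex.Re (\sum_(i <- r | P i) F i) = \sum_(i <- r | P i) complex.Re (F i).
Proof. exact: (big_morph _ ReD). Qed.

Lemma Im_sum (I : Type) (r : seq I) (P : pred I) (F : I -> R[i]) :
  complex.Im (\sum_(i <- r | P i) F i) = \sum_(i <- r | P i) complex.Im (F i).
Proof. exact: (big_morph _ ImD). Qed.

Lemma Re_rM (a : R) z : complex.Re (a%:C * z) = a * complex.Re z.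
Proof. by case: z => [x y] /=; rewrite mul0r subr0. Qed.

Lemma Im_rM (a : R) z : complex.Im (a%:C * z) = a * complex.Im z.
Proof. by case: z => [x y] /=; rewrite mul0r addr0. Qed.

Definition sqm z : R := complex.Re z ^+ 2 + complex.Im z ^+ 2.

Lemma sqmE z : z * z^*%C = (sqm z)%:C.
Proof.
case: z => [a b]; apply/eqP; rewrite eq_complex /sqm/=.
by apply/andP; split; apply/eqP; ring.
Qed.

Lemma sqm_ge0 z : 0 <= sqm z. Proof. by rewrite addr_ge0 ?sqr_ge0. Qed.

Lemma sqmM x y : sqm (x * y) = sqm x * sqm y.
Proof. by case: x y => [a b] [c d]; rewrite /sqm/=; ring. Qed.

Lemma sqm_conj z : sqm z^*%C = sqm z.
Proof. by case: z => [a b]; rewrite /sqm/=; ring. Qed.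

Lemma sqm_real (a : R) : sqm a%:C = a ^+ 2.
Proof. by rewrite /sqm/=; ring. Qed.

Lemma sqmN z : sqm (- z) = sqm z.
Proof. by case: z => [a b]; rewrite /sqm/=; ring. Qed.

Lemma sqmD_le x y : sqm (x + y) <= 2 * (sqm x + sqm y).
Proof.
case: x y => [a b] [c d]; rewrite /sqm/= -subr_ge0.
by rewrite (_ : _ - _ = (a - c) ^+ 2 + (b - d) ^+ 2) ?addr_ge0 ?sqr_ge0//; ring.
Qed.

(** Nonnegativity of the variance, for real and imaginary parts separately. These may be negative,
    so [jensen_exprn] does not apply to them. *)
Lemma sqm_jensen (I : finType) (w : I -> R) (z : I -> R[i]) :
  (forall i, 0 <= w i) -> \sum_i w i = 1 ->
  sqm (\sum_i (w i)%:C * z i) <= \sum_i w i * sqm (z i).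
Proof.
move=> w0 w1.
have sq (x : I -> R) : (\sum_i w i * x i) ^+ 2 <= \sum_i w i * x i ^+ 2.
  set a := \sum_i w i * x i.
  have : 0 <= \sum_i w i * (x i - a) ^+ 2.
    by apply: sumr_ge0 => i _; rewrite mulr_ge0 ?sqr_ge0.
  have e i : w i * (x i - a) ^+ 2 =
      w i * x i ^+ 2 - (2 * a) * (w i * x i) + a ^+ 2 * w i by ring.
  rewrite (eq_bigr _ (fun i _ => e i)) big_split/= sumrB -!mulr_sumr w1 -/a mulr1.
  move: (\sum_i _ * _ ^+ 2) => S; rewrite -[a ^+ 2 <= S]subr_ge0.
  by rewrite (_ : S - 2 * a * a + a ^+ 2 = S - a ^+ 2)//; ring.
rewrite /sqm Re_sum Im_sum.
under eq_bigr do rewrite Re_rM.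
under [in X in _ + X <= _]eq_bigr do rewrite Im_rM.
apply: le_trans (lerD (sq _) (sq _)) _.
by under [leRHS]eq_bigr do rewrite mulrDr; rewrite big_split.
Qed.

Lemma sqm_jensen_exprn (I : finType) (w : I -> R) (z : I -> R[i]) q :
  (forall i, 0 <= w i) -> \sum_i w i = 1 ->
  sqm (\sum_i (w i)%:C * z i) ^+ q <= \sum_i w i * sqm (z i) ^+ q.
Proof.
move=> w0 w1; apply: le_trans (jensen_exprn q w0 w1 (fun i => sqm_ge0 (z i))).
apply: lerXn2r (sqm_jensen _ w0 w1); rewrite nnegrE ?sqm_ge0//.
by apply: sumr_ge0 => i _; rewrite mulr_ge0 ?sqm_ge0.
Qed.

Definition csgn (b : bool) : R[i] := (sgn R b)%:C.

Lemma addr_exprn_le (a b : R) q : 0 <= a -> 0 <= b ->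
  a ^+ q + b ^+ q <= 2 * (a + b) ^+ q.
Proof.
move=> a0 b0; rewrite mulr_natl mulr2n lerD// lerXn2r ?nnegrE ?addr_ge0//.
  by rewrite lerDl.
by rewrite lerDr.
Qed.

(** [(2q)!] comes from the real inequality, [2^q] from separating real and imaginary parts under the
    power [q], and the last 2 from recombining them by [addr_exprn_le]. *)
Definition khconst (q : nat) : R := (2 ^ q.+1 * (2 * q)`!)%:R.

Lemma khconst_ge0 q : 0 <= khconst q. Proof. exact: ler0n. Qed.

Lemma khintchine (I : finType) (a : I -> R[i]) q :
  \sum_(e : {ffun I -> bool}) sqm (\sum_i csgn (e i) * a i) ^+ q <=
  #|{ffun I -> bool}|%:R * khconst q * (\sum_i sqm (a i)) ^+ q.
Proof.
set N := #|_|%:R.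
have N0 : 0 <= N by exact: ler0n.
pose x i := complex.Re (a i); pose y i := complex.Im (a i).
have -> : \sum_i sqm (a i) = \sum_i x i ^+ 2 + \sum_i y i ^+ 2.
  by rewrite -big_split.
have X0 : 0 <= \sum_i x i ^+ 2 by apply: sumr_ge0 => i _; exact: sqr_ge0.
have Y0 : 0 <= \sum_i y i ^+ 2 by apply: sumr_ge0 => i _; exact: sqr_ge0.
apply: (@le_trans _ _ (2 ^+ q * (N * (2 * q)`!%:R * (\sum_i x i ^+ 2) ^+ q +
    N * (2 * q)`!%:R * (\sum_i y i ^+ 2) ^+ q))); last first.
  rewrite -mulrDr /khconst natrM natrX exprS.
  have := ler_wpM2l (_ : 0 <= 2 ^+ q * (N * (2 * q)`!%:R)) (addr_exprn_le q X0 Y0).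
  move=> h; apply: le_trans (le_trans (h _) _);
    rewrite ?mulr_ge0 ?exprn_ge0 ?ler0n ?mulrA//.
  by rewrite le_eqVlt; apply/orP; left; apply/eqP; ring.
apply: le_trans
  (ler_wpM2l _ (lerD (khintchine_real x q) (khintchine_real y q))); last first.
  by rewrite exprn_ge0.
rewrite -big_split/= mulr_sumr; apply: ler_sum => e _.
have eRe : complex.Re (\sum_i csgn (e i) * a i) = ssum x e.
  by rewrite Re_sum; apply: eq_bigr => i _; rewrite Re_rM.
have eIm : complex.Im (\sum_i csgn (e i) * a i) = ssum y e.
  by rewrite Im_sum; apply: eq_bigr => i _; rewrite Im_rM.
rewrite /sqm eRe eIm !exprM.
case: q => [|q]; first by rewrite !expr0; lra.
have := @sum_exprn_le R bool
  (fun b => if b then ssum x e ^+ 2 else ssum y e ^+ 2) q.+1 isT.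
rewrite card_bool !big_bool/= => h.
apply: le_trans (h _) _; first by case; exact: sqr_ge0.
rewrite ler_wpM2r ?ler_weXn2l ?ler1n//.
by apply: addr_ge0; apply: exprn_ge0; exact: sqr_ge0.
Qed.

End SquaredModulus.

(** * Unitary matrices and states *)

Section UnitaryMatrices.
Context (R : rcfType) (d : nat).
Local Notation C := R[i].

Lemma trmxCE m n (A : 'M[C]_(m, n)) i j : A^t* i j = (A j i)^*%C.
Proof. by rewrite !mxE. Qed.

Lemma trmxCM m n p (A : 'M[C]_(m, n)) (B : 'M[C]_(n, p)) :
  (A *m B)^t* = B^t* *m A^t*.
Proof. by rewrite trmx_mul map_mxM. Qed.

Lemma mulmx_adjE m n p (X : 'M[C]_(m, n)) (h : 'M[C]_(p, n)) i j :
  (X *m h^t*) i j = ((h *m X^t*) j i)^*%C.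
Proof.
rewrite !mxE conjc_sum; apply: eq_bigr => k _.
by rewrite conjcM !trmxCE conjcK mulrC.
Qed.

Lemma conj_csgn b : (csgn R b)^*%C = csgn R b.
Proof. exact: conjc_real. Qed.

Lemma csgnK b : csgn R b * csgn R b = 1.
Proof. by rewrite /csgn /sgn -rmorphM/= -expr2 sqrr_sign. Qed.

Definition sign_mx (f : 'I_d -> bool) : 'M[C]_d :=
  diag_mx (\row_j csgn R (f j)).

Lemma sign_mx_unitary f : sign_mx f \is unitarymx.
Proof.
apply/unitarymxP/matrixP => i j; rewrite mul_diag_mx !mxE.
have [->|ij] := eqVneq i j; first by rewrite mulr1n conjCE conj_csgn csgnK.
by rewrite mulr0n conjCE conjc0 mulr0.
Qed.

Lemma sign_mxM p f (A : 'M[C]_(d, p)) i j : (sign_mx f *m A) i j = csgn R (f i) * A i j.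
Proof. by rewrite mul_diag_mx !mxE. Qed.

Lemma sign_mx_conj f (A : 'M[C]_d) i j :
  (sign_mx f *m A *m (sign_mx f)^t*) i j = csgn R (f i) * csgn R (f j) * A i j.
Proof.
rewrite -[_ *m A]trmxCK -trmxCM trmxCE sign_mxM trmxCE sign_mxM.
by rewrite !conjcM !conj_csgn conjcK mulrCA mulrA.
Qed.

(** As [w^t* *m w] squares to [|w|^2] times itself, the product with the adjoint is the identity
    minus [a + a^* - |a|^2 |w|^2] times [w^t* *m w]. A real [a] gives a Householder reflection, a
    complex one the rotation [pair_mx]. *)
Lemma reflection_unitary (w : 'rV[C]_d) (a : C) :
  a + a^*%C = a * a^*%C * (\sum_j w 0 j * (w 0 j)^*%C) ->
  1%:M - a *: (w^t* *m w) \is unitarymx.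
Proof.
move=> aE; apply/unitarymxP.
have -> : (1%:M - a *: (w^t* *m w))^t* = 1%:M - a^*%C *: (w^t* *m w).
  apply/matrixP => i j; rewrite !mxE !big_ord1 !mxE !conjCE conjcB !conjcM.
  by rewrite conjcK conjc_nat eq_sym [_^*%C * w _ _]mulrC.
have ww : w *m w^t* = (\sum_j w 0 j * (w 0 j)^*%C)%:M.
  rewrite [LHS]mx11_scalar; congr (_%:M); rewrite !mxE; apply: eq_bigr => j _.
  by rewrite trmxCE.
rewrite mulmxBl mul1mx mulmxBr mulmx1 -!scalemxAl -!scalemxAr scalerA.
rewrite -mulmxA (mulmxA w) ww mul_scalar_mx -scalemxAr scalerA -aE.
rewrite scalerDl; move: (a *: _) (a^*%C *: _) => x y.
by rewrite opprB [x + y]addrC addrK subrK.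
Qed.

(* The Householder reflection exchanging [e_i] and the flat unit vector. *)
Lemma flat_unitary (i : 'I_d) : (1 < d)%N ->
  exists2 V : 'M[C]_d, V \is unitarymx &
    forall j, V i j = (Num.sqrt d%:R)^-1%:C.
Proof.
move=> d1; set s : R := Num.sqrt _.
have s2 : s ^+ 2 = d%:R by rewrite sqr_sqrtr.
have s1 : 1 < s by rewrite -[X in X < _]sqrtr1 ltr_sqrt ?ltr0n ?ltr1n// ltnW.
have c1 : 1 - s^-1 != 0 by rewrite subr_eq0 gt_eqF// invf_lt1// (lt_trans ltr01).
have s0 : s != 0 by rewrite gt_eqF// (lt_trans ltr01).
(* [w] is [e_i] minus the flat unit vector, [|w|^2 = 2 (1 - 1/s)], and [a = 2 / |w|^2]; [1 < d]
   makes [w] nonzero. *)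
pose w : 'rV[C]_d := \row_j ((j == i)%:R - s^-1)%:C.
pose a : C := (1 - s^-1)^-1%:C.
exists (1%:M - a *: (w^t* *m w)).
  apply: reflection_unitary; rewrite conjc_real.
  have -> : \sum_j w 0 j * (w 0 j)^*%C = (2 * (1 - s^-1))%:C.
    rewrite (eq_bigr (fun j => ((j == i)%:R * (1 - 2 * s^-1) + s^-1 ^+ 2)%:C)).
      rewrite -rmorph_sum/= big_split/= -mulr_suml sumr_const card_ord; congr (_%:C).
      rewrite (bigD1 i)//= eqxx big1 => [|j /negPf ->//].
      by rewrite -[_ *+ d]mulr_natl -s2 -[true%:R]/(1 : R); field.
    move=> j _; rewrite mxE conjc_real -rmorphM/=; congr (_%:C).
    by case: (j == i) => /=; field.
  rewrite /a -!rmorphM -rmorphD/=; congr (_%:C).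
  by move: c1; set u := 1 - s^-1 => u0; field.
move=> j; rewrite !mxE big_ord1 !mxE eqxx conjCE conjc_real -!rmorphM eq_sym/=.
rewrite (_ : (j == i)%:R = (j == i)%:R%:C) -?rmorphB/=; last by rewrite rmorph_nat.
congr (_%:C); move: c1; set u := 1 - s^-1 => u0.
by rewrite mulrA mulVf// mul1r opprB addrC subrK.
Qed.

End UnitaryMatrices.

Lemma sum_mxtens (V : nmodType) m n (F : 'I_(m * n) -> V) :
  \sum_k F k = \sum_s \sum_e F (mxtens_index (s, e)).
Proof.
rewrite pair_big (reindex (@mxtens_index m n))/=; last first.
  by exists (@mxtens_unindex m n) => k _; rewrite (mxtens_indexK, mxtens_unindexK).
by apply: eq_bigr => -[].
Qed.

Section StateTheory.
Context (R : realType).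
Local Notation C := R[i].

Lemma hermsymmxP n (A : 'M[C]_n) : (A \is hermsymmx) <-> A^t* = A.
Proof.
split=> [/is_hermitianmxP|e]; first by rewrite expr0 scale1r => <-.
by apply/is_hermitianmxP; rewrite expr0 scale1r.
Qed.

Definition eigval n (A : 'M[C]_n) (k : 'I_n) : R := complex.Re (spectral_diag A 0 k).

Lemma psd_spectral n (A : 'M[C]_n) : psdmx A ->
  A = (spectralmx A)^t* *m diag_mx (\row_k (eigval A k)%:C) *m spectralmx A /\
  forall k, 0 <= eigval A k.
Proof.
move=> [hA pA]; set P := spectralmx A.
have Pu : P \is unitarymx := spectral_unitarymx A.
have PV : invmx P = P^t* := invmx_unitary Pu.
have DE : \row_k (eigval A k)%:C = spectral_diag A.
  apply/rowP => k; rewrite mxE.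
  by have /mxOverP/(_ 0 k) := hermitian_spectral_diag_real hA; move=> /RRe_real.
have AE : A = P^t* *m diag_mx (\row_k (eigval A k)%:C) *m P.
  by rewrite -PV DE; apply/orthomx_spectralP/hermitian_normalmx.
split=> // k; have := pA (row k P).
have -> : (row k P *m A *m (row k P)^t*) 0 0 = (P *m A *m P^t*) k k.
  by rewrite -row_mul !mxE; apply: eq_bigr => j _; rewrite !mxE.
have /unitarymxP PP := Pu.
rewrite {1}AE !mulmxA PP mul1mx -mulmxA PP mulmx1 mxE eqxx mulr1n mxE.
by rewrite ler0c.
Qed.

(** For a fixed unitary [Q], sums and products act on [l] alone, which turns matrix identities into
    identities between eigenvalues. *)
Definition hermdec n (l : 'I_n -> R) (Q : 'M[C]_n) : 'M[C]_n :=
  Q *m diag_mx (\row_k (l k)%:C) *m Q^t*.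

Lemma hermdecE n (l : 'I_n -> R) (Q : 'M[C]_n) i j :
  hermdec l Q i j = \sum_k (l k)%:C * (Q i k * (Q j k)^*%C).
Proof.
rewrite mxE; apply: eq_bigr => k _.
by rewrite mul_mx_diag mxE mxE trmxCE mulrAC mulrC.
Qed.

Lemma state_spectral n (A : 'M[C]_n) : is_state A ->
  [/\ A = hermdec (eigval A) ((spectralmx A)^t*),
      forall k, 0 <= eigval A k & \sum_k eigval A k = 1].
Proof.
move=> [pA trA]; have [AE l0] := psd_spectral pA.
have /unitarymxP PP := spectral_unitarymx A.
split=> //; first by rewrite /hermdec trmxCK.
apply: (@complexI R); rewrite -[RHS]trA {2}AE mxtrace_mulC mulmxA PP mul1mx.
by rewrite mxtrace_diag rmorph_sum/=; apply: eq_bigr => k _; rewrite mxE.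
Qed.

Lemma hermdec_herm n (l : 'I_n -> R) (Q : 'M[C]_n) : (hermdec l Q)^t* = hermdec l Q.
Proof.
apply/matrixP => i j; rewrite trmxCE !hermdecE conjc_sum; apply: eq_bigr => k _.
by rewrite !conjcM conjc_real conjcK [X in _ * X]mulrC.
Qed.

Lemma herm_psd n (A : 'M[C]_n) : A^t* = A ->
  (forall v : 'rV_n, 0 <= \sum_i \sum_j v 0 i * A i j * (v 0 j)^*%C) -> psdmx A.
Proof.
move=> hA pA; split; first exact/hermsymmxP.
move=> v; suff -> : (v *m A *m v^t*) 0 0 =
    \sum_i \sum_j v 0 i * A i j * (v 0 j)^*%C by exact: pA.
rewrite mxE exchange_big/=; apply: eq_bigr => j _.
by rewrite mxE trmxCE mulr_suml.
Qed.

Lemma psd_form_ge0 n (A : 'M[C]_n) (v : 'rV[C]_n) : psdmx A ->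
  0 <= \sum_i \sum_j v 0 i * A i j * (v 0 j)^*%C.
Proof.
move=> [_ /(_ v)]; congr (0 <= _).
rewrite mxE exchange_big/=; apply: eq_bigr => j _.
by rewrite mxE trmxCE mulr_suml.
Qed.

Lemma psd_herm n (A : 'M[C]_n) i j : psdmx A -> (A j i)^*%C = A i j.
Proof. by move=> [/hermsymmxP h _]; rewrite -trmxCE h. Qed.

Lemma state_conj n (U A : 'M[C]_n) : U \is unitarymx -> is_state A ->
  is_state (U *m A *m U^t*).
Proof.
move=> uU [[hA pA] trA]; have /hermsymmxP hA' := hA.
split; last first.
  rewrite mxtrace_mulC mulmxA; move: uU; rewrite -trmxC_unitary => /unitarymxP.
  by rewrite trmxCK => ->; rewrite mul1mx.
split; first by apply/hermsymmxP; rewrite !trmxCM trmxCK hA' mulmxA.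
move=> v; have := pA (v *m U); congr (0 <= _).
by rewrite trmxCM !mulmxA.
Qed.

Lemma ptraceE_tr dS dE (A : 'M[C]_(dS * dE)) : \tr (ptraceE A) = \tr A.
Proof.
by rewrite /mxtrace sum_mxtens; apply: eq_bigr => s _; rewrite mxE.
Qed.

Lemma ptraceE_state dS dE (A : 'M[C]_(dS * dE)) : is_state A -> is_state (ptraceE A).
Proof.
move=> [pA trA]; split; last by rewrite ptraceE_tr.
apply: herm_psd.
  apply/matrixP => s t; rewrite trmxCE !mxE conjc_sum.
  by apply: eq_bigr => e _; rewrite (psd_herm _ _ pA).
move=> v.
(* [w e] is [v] tensored with the basis vector [e] of [H_E]; the form of the partial trace at [v] is
   the sum of the forms of [A] at these vectors. *)
pose w e : 'rV[C]_(dS * dE) :=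
  \row_k (v 0 (mxtens_unindex k).1 * (e == (mxtens_unindex k).2)%:R).
suff -> : \sum_i \sum_j v 0 i * ptraceE A i j * (v 0 j)^*%C =
    \sum_e \sum_i \sum_j w e 0 i * A i j * (w e 0 j)^*%C.
  by apply: sumr_ge0 => e _; exact: psd_form_ge0.
rewrite [RHS]exchange_big [RHS]sum_mxtens/=.
transitivity (\sum_s \sum_t \sum_e
    v 0 s * A (mxtens_index (s, e)) (mxtens_index (t, e)) * (v 0 t)^*%C).
  apply: eq_bigr => s _; apply: eq_bigr => t _.
  by rewrite mxE mulr_sumr mulr_suml.
apply: eq_bigr => s _; rewrite exchange_big/=; apply: eq_bigr => e _.
rewrite [RHS](bigD1 e)//= [X in _ = _ + X]big1 ?addr0; last first.
  move=> f fe; rewrite big1// => j _.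
  by rewrite mxE mxtens_indexK/= (negPf fe) mulr0 !mul0r.
rewrite sum_mxtens; apply: eq_bigr => t _.
rewrite [RHS](bigD1 e)//= [X in _ = _ + X]big1 ?addr0; last first.
  move=> f fe.
  by rewrite !mxE !mxtens_indexK/= [e == f]eq_sym (negPf fe) mulr0 conjc0 mulr0.
by rewrite !mxE !mxtens_indexK/= eqxx !mulr1.
Qed.

End StateTheory.

(** * Expectation of bounded measurable functions *)

Section BoundedMeasurable.
Context d (T : measurableType d) (R : realType).
Implicit Types (f g : T -> R) (P : probability T R).

(** Boundedness, unlike integrability, is stable under products. Entries of unitary matrices are
    bounded, and integrability then holds for every probability. *)
Definition bmf f := measurable_fun setT f /\ exists M, forall x, `|f x| <= M.

Lemma bmf_cst c : bmf (fun=> c).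
Proof. by split; [exact: measurable_cst | exists `|c|]. Qed.

Lemma bmfD f g : bmf f -> bmf g -> bmf (fun x => f x + g x).
Proof.
move=> [mf [M fM]] [mg [N gN]]; split; first exact: measurable_funD.
by exists (M + N) => x; rewrite (le_trans (ler_normD _ _))// lerD.
Qed.

Lemma bmfM f g : bmf f -> bmf g -> bmf (fun x => f x * g x).
Proof.
move=> [mf [M fM]] [mg [N gN]]; split; first exact: measurable_funM.
by exists (M * N) => x; rewrite normrM ler_pM.
Qed.

Lemma bmfZ (c : R) f : bmf f -> bmf (fun x => c * f x).
Proof. by move=> bf; apply: bmfM => //; exact: bmf_cst. Qed.

Lemma bmfN f : bmf f -> bmf (fun x => - f x).
Proof. by move=> /(bmfZ (-1)); under eq_fun do rewrite mulN1r. Qed.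

Lemma bmfB f g : bmf f -> bmf g -> bmf (fun x => f x - g x).
Proof. by move=> bf bg; apply: bmfD => //; exact: bmfN. Qed.

Lemma bmfX f n : bmf f -> bmf (fun x => f x ^+ n).
Proof.
move=> bf; elim: n => [|n IHn]; first exact: bmf_cst.
by under eq_fun do rewrite exprS; exact: bmfM.
Qed.

Lemma bmf_sum (I : Type) (r : seq I) (F : I -> T -> R) :
  (forall i, bmf (F i)) -> bmf (fun x => \sum_(i <- r) F i x).
Proof.
move=> bF; elim: r => [|i r IHr].
  by under eq_fun do rewrite big_nil; exact: bmf_cst.
by under eq_fun do rewrite big_cons; exact: bmfD.
Qed.

Lemma bmf_integrable P f : bmf f -> P.-integrable setT (EFin \o f).
Proof.
move=> [mf [M fM]]; apply: measurable_bounded_integrable => //.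
  by rewrite -ge0_fin_numE//; exact: fin_num_measure.
exists M; split; first exact: num_real.
by move=> N MN x _; apply: le_trans (fM x) _; exact: ltW.
Qed.

Definition Ex P f : R := fine 'E_P[f].

Lemma ExE P f : Ex P f = \int[P]_x f x.
Proof. by rewrite /Ex unlock. Qed.

Lemma Ex_cst P c : Ex P (fun=> c) = c.
Proof. by rewrite /Ex expectation_cst. Qed.

Lemma ExD P f g : bmf f -> bmf g -> Ex P (fun x => f x + g x) = Ex P f + Ex P g.
Proof. by move=> bf bg; rewrite !ExE RintegralD//; exact: bmf_integrable. Qed.

Lemma ExZ P c f : bmf f -> Ex P (fun x => c * f x) = c * Ex P f.
Proof. by move=> bf; rewrite !ExE RintegralZl//; exact: bmf_integrable. Qed.

Lemma ExB P f g : bmf f -> bmf g -> Ex P (fun x => f x - g x) = Ex P f - Ex P g.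
Proof.
move=> bf bg; rewrite ExD//; last exact: bmfN.
by congr (_ + _); under eq_fun do rewrite -mulN1r; rewrite ExZ// mulN1r.
Qed.

Lemma le_Ex P f g : bmf f -> bmf g -> (forall x, f x <= g x) -> Ex P f <= Ex P g.
Proof. by move=> bf bg fg; rewrite !ExE le_Rintegral//; exact: bmf_integrable. Qed.

Lemma Ex_sum P (I : Type) (r : seq I) (F : I -> T -> R) : (forall i, bmf (F i)) ->
  Ex P (fun x => \sum_(i <- r) F i x) = \sum_(i <- r) Ex P (F i).
Proof.
move=> bF; elim: r => [|i r IHr].
  by under eq_fun do rewrite big_nil; rewrite Ex_cst big_nil.
under eq_fun do rewrite big_cons.
by rewrite ExD//; [rewrite big_cons IHr | exact: bmf_sum].
Qed.

Lemma Ex_markov P f (A : set T) (a : R) : measurable A -> bmf f ->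
  (forall x, 0 <= f x) -> (forall x, A x -> a <= f x) ->
  a * fine (P A) <= Ex P f.
Proof.
move=> mA bf f0 Aa.
have b1 : bmf (\1_A : T -> R).
  split; first exact: measurable_indic.
  by exists 1 => x; rewrite indicE; case: (x \in A); rewrite ?normr0 ?normr1.
have -> : fine (P A) = Ex P (\1_A : T -> R) by rewrite /Ex expectation_indic.
rewrite -ExZ//; apply: le_Ex => //; first exact: bmfZ.
move=> x; rewrite indicE.
have [/set_mem/Aa|_] := boolP (x \in A); first by rewrite mulr1.
by rewrite mulr0.
Qed.

End BoundedMeasurable.

Section ComplexMeasurable.
Context d (T : measurableType d) (R : realType).
Implicit Types (f g : T -> R[i]).

Definition cbm f := bmf (fun x => complex.Re (f x)) /\ bmf (fun x => complex.Im (f x)).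

Lemma cbm_cst c : cbm (fun=> c). Proof. by split; exact: bmf_cst. Qed.

Lemma cbmD f g : cbm f -> cbm g -> cbm (fun x => f x + g x).
Proof.
move=> [f1 f2] [g1 g2]; split.
  by under eq_fun do rewrite ReD; exact: bmfD.
by under eq_fun do rewrite ImD; exact: bmfD.
Qed.

Lemma cbmM f g : cbm f -> cbm g -> cbm (fun x => f x * g x).
Proof.
move=> [f1 f2] [g1 g2]; split.
  rewrite (_ : (fun _ => _) = fun x => complex.Re (f x) * complex.Re (g x) -
    complex.Im (f x) * complex.Im (g x)); first by apply: bmfB; exact: bmfM.
  by apply/funext => x; case: (f x) (g x) => [a b] [c e].
rewrite (_ : (fun _ => _) = fun x => complex.Re (f x) * complex.Im (g x) +
  complex.Im (f x) * complex.Re (g x)); first by apply: bmfD; exact: bmfM.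
by apply/funext => x; case: (f x) (g x) => [a b] [c e].
Qed.

Lemma cbm_conj f : cbm f -> cbm (fun x => (f x)^*%C).
Proof.
move=> [f1 f2]; split.
  rewrite (_ : (fun _ => _) = fun x => complex.Re (f x))//.
  by apply/funext => x; case: (f x).
rewrite (_ : (fun _ => _) = fun x => - complex.Im (f x)); first exact: bmfN.
by apply/funext => x; case: (f x).
Qed.

Lemma cbmN f : cbm f -> cbm (fun x => - f x).
Proof.
move=> bf; under eq_fun do rewrite -mulN1r.
by apply: cbmM => //; exact: cbm_cst.
Qed.

Lemma cbm_sum (I : Type) (r : seq I) (F : I -> T -> R[i]) :
  (forall i, cbm (F i)) -> cbm (fun x => \sum_(i <- r) F i x).
Proof.
move=> bF; elim: r => [|i r IHr].
  by under eq_fun do rewrite big_nil; exact: cbm_cst.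
by under eq_fun do rewrite big_cons; exact: cbmD.
Qed.

Lemma cbm_prod (I : Type) (r : seq I) (F : I -> T -> R[i]) :
  (forall i, cbm (F i)) -> cbm (fun x => \prod_(i <- r) F i x).
Proof.
move=> bF; elim: r => [|i r IHr].
  by under eq_fun do rewrite big_nil; exact: cbm_cst.
by under eq_fun do rewrite big_cons; exact: cbmM.
Qed.

Lemma bmf_sqm f : cbm f -> bmf (fun x => sqm (f x)).
Proof. by move=> [f1 f2]; apply: bmfD; exact: bmfX. Qed.

Definition mxbm m n (F : T -> 'M[R[i]]_(m, n)) := forall i j, cbm (fun x => F x i j).

Lemma mxbm_cst m n (A : 'M[R[i]]_(m, n)) : mxbm (fun=> A).
Proof. by move=> i j; exact: cbm_cst. Qed.

Lemma mxbmM m n p (F : T -> 'M[R[i]]_(m, n)) (G : T -> 'M[R[i]]_(n, p)) :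
  mxbm F -> mxbm G -> mxbm (fun x => F x *m G x).
Proof.
move=> bF bG i j; under eq_fun do rewrite mxE.
by apply: cbm_sum => k; exact: cbmM.
Qed.

Lemma mxbmB m n (F G : T -> 'M[R[i]]_(m, n)) :
  mxbm F -> mxbm G -> mxbm (fun x => F x - G x).
Proof.
move=> bF bG i j; under eq_fun do rewrite !mxE.
by apply: cbmD => //; exact: cbmN.
Qed.

Lemma mxbm_adj m n (F : T -> 'M[R[i]]_(m, n)) : mxbm F -> mxbm (fun x => (F x)^t* ).
Proof. by move=> bF i j; under eq_fun do rewrite trmxCE; exact: cbm_conj. Qed.

Lemma cbm_tr n (F : T -> 'M[R[i]]_n) : mxbm F -> cbm (fun x => (\tr (F x))%R).
Proof. by move=> bF; exact: cbm_sum. Qed.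

End ComplexMeasurable.

(** * Left translations and averaging over the Haar measure *)

Section UnitaryGroup.
Context (R : realType) (d : nat).
Local Notation C := R[i].
Local Notation T := (unitaryGroup R d).

Lemma unitary_row_sqm (U : 'M[C]_d) i : U \is unitarymx -> \sum_j sqm (U i j) = 1.
Proof.
move=> /unitarymxP/matrixP/(_ i i); rewrite !mxE eqxx => e.
apply: (@complexI R); rewrite rmorph_sum/= -[RHS]e; apply: eq_bigr => j _.
by rewrite trmxCE sqmE.
Qed.

Lemma unitary_col_sqm (U : 'M[C]_d) j : U \is unitarymx -> \sum_i sqm (U i j) = 1.
Proof.
rewrite -trmxC_unitary => /(unitary_row_sqm j) <-; apply: eq_bigr => i _.
by rewrite trmxCE sqm_conj.
Qed.

Lemma unitary_sqm_le1 (U : 'M[C]_d) i j : U \is unitarymx -> sqm (U i j) <= 1.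
Proof.
move=> /(unitary_row_sqm i) <-; rewrite (bigD1 j)//= lerDl.
by apply: sumr_ge0 => k _; exact: sqm_ge0.
Qed.

Lemma mxbm_val : mxbm (fun U : T => (val U : 'M[C]_d)).
Proof.
move=> i j.
have le1 (U : T) : sqm (val U i j) <= 1 by apply: unitary_sqm_le1; exact: valP U.
have ab (a b : R) : a ^+ 2 + b ^+ 2 <= 1 -> `|a| <= 1.
  move=> h; rewrite -(@ler_pXn2r _ 2)// ?nnegrE// expr1n -normrX ger0_norm ?sqr_ge0//.
  by rewrite (le_trans _ h)// lerDl sqr_ge0.
split; (split; last first); first by exists 1 => U; exact: ab (le1 U).
- move=> _ B mB; rewrite setTI; apply: sub_sigma_algebra.
  by exists i, j, B; split=> //; left.
- by exists 1 => U; apply: (ab _ (complex.Re (val U i j))); rewrite addrC; exact: le1.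
- move=> _ B mB; rewrite setTI; apply: sub_sigma_algebra.
  by exists i, j, B; split=> //; right.
Qed.

Lemma measurable_unitary_mul (V : unitary R d) :
  measurable_fun setT (fun U : T => unitary_mul V U : T).
Proof.
have bVU : mxbm (fun U : T => val V *m val U : 'M[C]_d).
  by apply: mxbmM; [exact: mxbm_cst | exact: mxbm_val].
apply: (@measurability _ _ T T setT _ (@unitary_entry_sets R d)) => //.
move=> _ [_ [i [j [B [mB [->|->]]]]] <-]; rewrite setTI.
  by have [[+ _] _] := bVU i j; move=> /(_ measurableT _ mB); rewrite setTI.
by have [_ [+ _]] := bVU i j; move=> /(_ measurableT _ mB); rewrite setTI.
Qed.

Lemma Ex_haar (H : probability T R) (V : unitary R d) (f : T -> R) : is_haar H ->
  bmf f -> Ex H (fun U => f (unitary_mul V U)) = Ex H f.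
Proof.
move=> hH bf; have mphi := measurable_unitary_mul V.
have bfV : bmf (fun U : T => f (unitary_mul V U)).
  have [mf [M fM]] := bf; split; last by exists M => U; exact: fM.
  exact: (measurableT_comp mf).
rewrite !ExE /Rintegral; congr fine.
have := @integral_pushforward _ _ T T R _ mphi H setT (EFin \o f).
rewrite preimage_setT => <-//.
- apply: eq_measure_integral => A mA _.
  by rewrite /pushforward; exact: hH.
- by apply/measurable_EFinP; case: bf.
- exact: bmf_integrable bfV.
Qed.

(** The symmetrization principle: all translates of [f] have the same expectation, so [f] may be
    averaged over a finite family before it is bounded pointwise by [g]. *)
Lemma Ex_haar_avg (I : finType) (H : probability T R) (V : I -> unitary R d)
    (f g : T -> R) :
  is_haar H -> bmf f -> bmf g -> (0 < #|I|)%N ->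
  (forall U, \sum_e f (unitary_mul (V e) U) <= #|I|%:R * g U) -> Ex H f <= Ex H g.
Proof.
move=> hH bf bg I0 h; rewrite -(@ler_pM2l _ #|I|%:R) ?ltr0n//.
rewrite -[leRHS]ExZ//.
have bfV e : bmf (fun U : T => f (unitary_mul (V e) U)).
  have [mf [M fM]] := bf; split; last by exists M => U; exact: fM.
  exact: (measurableT_comp mf (measurable_unitary_mul _)).
have := le_Ex H (bmf_sum (index_enum I) bfV) (bmfZ #|I|%:R bg) h; apply: le_trans.
rewrite Ex_sum// (eq_bigr (fun=> Ex H f)) => [|e _]; last exact: Ex_haar.
by rewrite sumr_const mulr_natl.
Qed.

End UnitaryGroup.

(** * Haar moments *)

Section EntryMoments.
Context (R : realType) (d : nat).
Local Notation C := R[i].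
Local Notation T := (unitaryGroup R d).
Variable H : probability T R.
Hypothesis hH : is_haar H.
Hypothesis d1 : (1 < d)%N.

Lemma card_signs_gt0 (I : finType) : (0 < #|{ffun I -> bool}|)%N.
Proof. by apply/card_gt0P; exists [ffun=> true]. Qed.

(** After translation the entry is [1 / sqrt d] times a signed sum over column [k] of [U Q], whose
    norm is 1 whatever [U] is. [Q] will hold the eigenvectors of the state. *)
Lemma haar_entry_moment (Q : 'M[C]_d) (i k : 'I_d) q : Q \is unitarymx ->
  Ex H (fun U => sqm ((val U *m Q) i k) ^+ q) <= khconst R q / d%:R ^+ q.
Proof.
move=> uQ; have [F uF FE] := flat_unitary R i d1.
pose V (e : {ffun 'I_d -> bool}) : unitary R d :=
  exist _ (F *m sign_mx R e) (mul_unitarymx uF (sign_mx_unitary R e)).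
have bUQ : mxbm (fun U : T => val U *m Q).
  by apply: mxbmM; [exact: mxbm_val | exact: mxbm_cst].
rewrite -[leRHS](Ex_cst H).
apply: (Ex_haar_avg (V := V) hH);
  [exact/bmfX/bmf_sqm|exact: bmf_cst|exact: card_signs_gt0|].
move=> U; set a := fun j => (val U *m Q) j k.
have VE e : (val (unitary_mul (V e) U) *m Q) i k =
    (Num.sqrt d%:R)^-1%:C * \sum_j csgn R (e j) * a j.
  rewrite /= -!mulmxA mxE mulr_sumr; apply: eq_bigr => j _.
  by rewrite FE sign_mxM.
under eq_bigr => e _ do rewrite VE sqmM sqm_real exprVn sqr_sqrtr// exprMn.
have dq0 : 0 <= (d%:R^-1 : R) ^+ q by rewrite exprn_ge0 ?invr_ge0.
rewrite -mulr_sumr; apply: le_trans (ler_wpM2l dq0 (khintchine a q)) _.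
have -> : \sum_j sqm (a j) = 1 := unitary_col_sqm k (mul_unitarymx (valP U) uQ).
by rewrite expr1n mulr1 mulrC -mulrA exprVn.
Qed.

Variable rho : 'M[C]_d.
Hypothesis rho_state : is_state rho.

Lemma mxbm_conj_unitary : mxbm (fun U : T => conj_unitary U rho).
Proof.
apply: mxbmM; last by apply: mxbm_adj; exact: mxbm_val.
by apply: mxbmM; [exact: mxbm_val | exact: mxbm_cst].
Qed.

Lemma conj_unitary_mul (V : unitary R d) (U : T) :
  conj_unitary (unitary_mul V U : T) rho = val V *m conj_unitary U rho *m (val V)^t*.
Proof. by rewrite /conj_unitary trmxCM !mulmxA. Qed.

(** Mixed states are handled by convexity: the eigenvalues of [rho] serve as weights in Jensen's
    inequality. The inequality [a b <= (a^2 + b^2) / 2] then separates the two entries of [W], which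
    doubles the exponent to [2 * m]. *)
Lemma haar_psi_moment i j m :
  Ex H (fun U => sqm (conj_unitary U rho i j) ^+ m) <=
  khconst R (2 * m) / d%:R ^+ (2 * m).
Proof.
have [rhoE l0 l1] := state_spectral rho_state.
move: rhoE l0 l1; set l := eigval rho; set Q := _^t* => rhoE l0 l1.
have uQ : Q \is unitarymx by rewrite trmxC_unitary; exact: spectral_unitarymx.
pose W (U : T) := val U *m Q.
have bW : mxbm W by apply: mxbmM; [exact: mxbm_val | exact: mxbm_cst].
have psiE U : conj_unitary U rho i j = \sum_k (l k)%:C * (W U i k * (W U j k)^*%C).
  rewrite -hermdecE; congr (fun_of_matrix _ i j).
  by rewrite /conj_unitary {1}rhoE /hermdec trmxCM !mulmxA.
pose y i k (U : T) := sqm (W U i k) ^+ (2 * m).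
have bF k i' : bmf (y i' k) by exact/bmfX/bmf_sqm.
pose g (U : T) := \sum_k l k * (2^-1 * (y i k U + y j k U)).
have bg : bmf g by apply: bmf_sum => k; apply/bmfZ/bmfZ/bmfD.
have bpsi : bmf (fun U : T => sqm (conj_unitary U rho i j) ^+ m).
  by apply/bmfX/bmf_sqm; exact: mxbm_conj_unitary.
apply: (@le_trans _ _ (Ex H g)).
  apply: le_Ex => // U; rewrite psiE; apply: le_trans (sqm_jensen_exprn _ _ l0 l1) _.
  apply: ler_sum => k _; rewrite ler_wpM2l// sqmM sqm_conj exprMn /y mulnC !exprM.
  move: (_ ^+ m) (_ ^+ m) => a b.
  rewrite -subr_ge0 (_ : _ - _ = 2^-1 * (a - b) ^+ 2); last by field.
  by rewrite mulr_ge0 ?sqr_ge0.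
rewrite Ex_sum; last by move=> k; apply/bmfZ/bmfZ/bmfD.
rewrite [leRHS](_ : _ = \sum_k l k * (khconst R (2 * m) / d%:R ^+ (2 * m))); last first.
  by rewrite -mulr_suml l1 mul1r.
apply: ler_sum => k _.
rewrite ExZ; last exact/bmfZ/bmfD.
rewrite ler_wpM2l// ExZ; last exact: bmfD.
rewrite ExD// ler_pdivrMl// mulr_natl mulr2n.
by apply: lerD; exact: haar_entry_moment.
Qed.

End EntryMoments.

Section ReducedMoments.
Context (R : realType) (dS dE : nat).
Local Notation C := R[i].
Local Notation d := (dS * dE)%N.
Local Notation T := (unitaryGroup R d).
Variable H : probability T R.
Hypothesis hH : is_haar H.
Hypothesis d1 : (1 < d)%N.
Variable rho : 'M[C]_d.
Hypothesis rho_state : is_state rho.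

Definition reduced (U : T) : 'M[C]_dS := ptraceE (conj_unitary U rho).

Lemma mxbm_reduced : mxbm reduced.
Proof.
move=> s t; rewrite /reduced; under eq_fun do rewrite mxE.
by apply: cbm_sum => e; exact: mxbm_conj_unitary.
Qed.

Lemma reduced_state U : is_state (reduced U).
Proof. by apply/ptraceE_state/state_conj => //; exact: valP U. Qed.

(** Khintchine's constant for signs on [H_E], then [dE] terms under the power [m], then
    [haar_psi_moment]. Apart from the constants this is [(dS * d)^(-m)]. *)
Definition offdiag_bound m : R :=
  khconst R m * (dE%:R ^+ m * (khconst R (2 * m) / d%:R ^+ (2 * m))).

Lemma haar_offdiag_moment s t m : s != t -> (0 < m)%N ->
  Ex H (fun U => sqm (reduced U s t) ^+ m) <= offdiag_bound m.
Proof.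
move=> st m0.
(* The signs act on the block [s] only; as [t] differs from [s], each term of the partial trace
   giving [Z s t] picks up exactly one sign. *)
pose f (e : {ffun 'I_dE -> bool}) (k : 'I_d) :=
  ((mxtens_unindex k).1 == s) && e (mxtens_unindex k).2.
pose V e : unitary R d := exist _ (sign_mx R (f e)) (sign_mx_unitary R (f e)).
pose x e (U : T) := conj_unitary U rho (mxtens_index (s, e)) (mxtens_index (t, e)).
have bx e : cbm (x e) by exact: mxbm_conj_unitary.
pose g (U : T) := khconst R m * (\sum_e sqm (x e U)) ^+ m.
have bg : bmf g by apply/bmfZ/bmfX/bmf_sum => e; exact: bmf_sqm.
apply: (@le_trans _ _ (Ex H g)).
  apply: (Ex_haar_avg (V := V) hH) => //; [|exact: card_signs_gt0|].
    by apply/bmfX/bmf_sqm; exact: mxbm_reduced.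
  move=> U; rewrite mulrA; apply: le_trans (khintchine (x^~ U) m).
  apply: ler_sum => e _; rewrite le_eqVlt; apply/orP; left; apply/eqP.
  congr (sqm _ ^+ _); rewrite mxE; apply: eq_bigr => k _.
  rewrite conj_unitary_mul sign_mx_conj /f !mxtens_indexK/= eqxx/=.
  by rewrite [t == s]eq_sym (negPf st)/= [csgn R false]/csgn /sgn expr0 mulr1.
rewrite /g ExZ; last by apply/bmfX/bmf_sum => e; exact: bmf_sqm.
rewrite ler_wpM2l ?khconst_ge0//.
have bs : bmf (fun U => \sum_e sqm (x e U) ^+ m).
  by apply: bmf_sum => e; exact/bmfX/bmf_sqm.
apply: (@le_trans _ _ (Ex H (fun U => dE%:R ^+ m.-1 * \sum_e sqm (x e U) ^+ m))).
  apply: le_Ex; [|exact: bmfZ|].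
    by apply/bmfX/bmf_sum => e; exact: bmf_sqm.
  move=> U; rewrite -[X in X%:R ^+ _]card_ord; apply: sum_exprn_le => // e.
  exact: sqm_ge0.
rewrite ExZ// Ex_sum; last by move=> e; exact/bmfX/bmf_sqm.
rewrite -[in leRHS](prednK m0) exprSr -mulrA ler_wpM2l ?exprn_ge0//.
rewrite prednK// mulr_natl -[X in _ *+ X]card_ord -sumr_const; apply: ler_sum => e _.
exact: haar_psi_moment.
Qed.

End ReducedMoments.

(** * The rotation that exchanges diagonal differences and off-diagonal entries *)

Section PairReflection.
Context (R : realType) (dS : nat).
Local Notation C := R[i].
Variables (s t : 'I_dS) (st : s != t).

Definition pair_row : 'rV[C]_dS := \row_j ((j == s)%:R - (j == t)%:R).
(* [pair_mx] acts on the span of [e_s], [e_t] as the matrix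
   [[(1+i)/2, (1-i)/2], [(1-i)/2, (1+i)/2]]. *)
Definition half_i : C := 2^-1 -i* 2^-1.
Definition pair_mx : 'M[C]_dS := 1%:M - half_i *: (pair_row^t* *m pair_row).

Lemma conj_pair_row i : (pair_row 0 i)^*%C = pair_row 0 i.
Proof. by rewrite mxE conjcB !conjc_nat. Qed.

Lemma pair_row_l : pair_row 0 s = 1.
Proof. by rewrite mxE eqxx (negPf st) subr0. Qed.

Lemma pair_row_r : pair_row 0 t = -1.
Proof. by rewrite mxE eqxx eq_sym (negPf st) sub0r. Qed.

Lemma pair_row_out j : j != s -> j != t -> pair_row 0 j = 0.
Proof. by rewrite mxE => /negPf-> /negPf->; rewrite subrr. Qed.

Lemma pair_mx_unitary : pair_mx \is unitarymx.
Proof.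
apply: reflection_unitary.
have -> : \sum_j pair_row 0 j * (pair_row 0 j)^*%C = 2.
  under eq_bigr do rewrite conj_pair_row.
  rewrite (bigD1 s)//= (bigD1 t)//=; last by rewrite eq_sym.
  rewrite big1 => [|j /andP[js jt]]; last by rewrite pair_row_out ?mul0r.
  by rewrite pair_row_l pair_row_r; ring.
rewrite /half_i; apply/eqP; rewrite eq_complex/=.
by apply/andP; split; apply/eqP; field.
Qed.

Lemma pair_mxM n (A : 'M[C]_(dS, n)) i j :
  (pair_mx *m A) i j = A i j - half_i * (pair_row 0 i * (A s j - A t j)).
Proof.
have wA : (pair_row *m A) 0 j = A s j - A t j.
  rewrite mxE (bigD1 s)//= (bigD1 t)//=; last by rewrite eq_sym.
  rewrite big1 => [|k /andP[ks kt]]; last by rewrite pair_row_out ?mul0r.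
  by rewrite pair_row_l pair_row_r; ring.
rewrite mulmxBl mul1mx -scalemxAl -mulmxA mxE; congr (_ + _).
rewrite mxE; congr (- _); rewrite mxE; congr (_ * _).
by rewrite mxE big_ord1 trmxCE conj_pair_row wA.
Qed.

(** On the pair [s], [t] the matrix is the square root of NOT, a quarter turn of the Bloch sphere
    that carries the Pauli matrix Z to Y up to sign convention. *)
Lemma pair_mx_conj_diff (A : 'M[C]_dS) :
  (pair_mx *m A *m pair_mx^t*) s s - (pair_mx *m A *m pair_mx^t*) t t =
  'i%C * (A s t - A t s).
Proof.
have E i : (pair_mx *m A *m pair_mx^t*) i i =
    (pair_mx *m A) i i -
    half_i^*%C * (pair_row 0 i * ((pair_mx *m A) i s - (pair_mx *m A) i t)).
  rewrite mulmx_adjE [X in X^*%C]pair_mxM.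
  by rewrite conjcB !conjcM conjcB !trmxCE !conjcK conj_pair_row.
rewrite !E !pair_mxM.
rewrite pair_row_l pair_row_r.
(* Expressing the conjugate and ['i] through [half_i] leaves a polynomial identity for [ring]. *)
have -> : half_i^*%C = 1 - half_i.
  by apply/eqP; rewrite eq_complex /=; apply/andP; split; apply/eqP; field.
have -> : 'i%C = 1 - 2 * half_i.
  by apply/eqP; rewrite eq_complex /=; apply/andP; split; apply/eqP; field.
ring.
Qed.

End PairReflection.

Section ReducedMoments.
Context (R : realType) (dS dE : nat).
Local Notation C := R[i].
Local Notation d := (dS * dE)%N.
Local Notation T := (unitaryGroup R d).
Variable H : probability T R.
Hypothesis hH : is_haar H.
Hypothesis d1 : (1 < d)%N.
Variable rho : 'M[C]_d.
Hypothesis rho_state : is_state rho.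
Local Notation Z := (reduced rho).

Lemma tens1_unitary (h : 'M[C]_dS) : h \is unitarymx ->
  tensmx h (1%:M : 'M[C]_dE) \is unitarymx.
Proof.
move=> /unitarymxP hh; apply/unitarymxP.
rewrite trmx_tens map_mxT trmx1 map_mx1 tensmx_mul hh mulmx1.
apply/matrixP => i j; case: (mxtens_indexP i) => s e; case: (mxtens_indexP j) => t f.
rewrite tensmxE !mxE -natrM mulnb; congr (_%:R); congr nat_of_bool.
by rewrite (can_eq (@mxtens_indexK _ _)) xpair_eqE.
Qed.

(** A unitary acting on [H_S] alone passes through the partial trace, so invariance on the whole
    space yields invariance of the law of [Z] under conjugation. *)
Lemma ptraceE_tens1 (h : 'M[C]_dS) (A : 'M[C]_d) :
  ptraceE (tensmx h (1%:M : 'M[C]_dE) *m A *m (tensmx h (1%:M : 'M[C]_dE))^t*) =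
  h *m ptraceE A *m h^t*.
Proof.
have tM (g : 'M[C]_dS) (B : 'M[C]_d) s e k :
    (tensmx g (1%:M : 'M[C]_dE) *m B) (mxtens_index (s, e)) k =
    \sum_u g s u * B (mxtens_index (u, e)) k.
  rewrite mxE sum_mxtens; apply: eq_bigr => u _.
  rewrite (bigD1 e)//= big1 ?addr0 => [|f fe].
    by rewrite tensmxE mxE eqxx mulr1.
  by rewrite tensmxE mxE eq_sym (negPf fe) mulr0 mul0r.
apply/matrixP => s t; rewrite !mxE.
transitivity (\sum_e \sum_u
  (\sum_v h s v * A (mxtens_index (v, e)) (mxtens_index (u, e))) * (h t u)^*%C).
  apply: eq_bigr => e _.
  rewrite mulmx_adjE tM conjc_sum.
  by apply: eq_bigr => u _; rewrite conjcM trmxCE conjcK tM mulrC.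
rewrite exchange_big/=; apply: eq_bigr => u _.
rewrite -mulr_suml trmxCE; congr (_ * _).
rewrite exchange_big mxE/=; apply: eq_bigr => v _.
by rewrite mxE mulr_sumr.
Qed.

(** The factor [4^m] is [2^m] from [sqmD_le], [2^(m-1)] from the power mean of two terms, and 2 for
    the entries [Z s t] and [Z t s]. *)
Lemma haar_diag_diff_moment s t m : s != t -> (0 < m)%N ->
  Ex H (fun U => sqm (Z U s s - Z U t t) ^+ m) <= 4 ^+ m * offdiag_bound R dS dE m.
Proof.
move=> st m0.
pose V : unitary R d :=
  exist _ (tensmx (pair_mx R s t) (1%:M : 'M[C]_dE))
    (tens1_unitary (pair_mx_unitary R st)).
have bZ i j : cbm (fun U => Z U i j) := mxbm_reduced rho i j.
have bd : cbm (fun U => Z U s s - Z U t t) by apply: cbmD => //; exact: cbmN.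
have b1 i j : bmf (fun U => sqm (Z U i j) ^+ m) by exact/bmfX/bmf_sqm.
rewrite -(Ex_haar V hH (bmfX m (bmf_sqm bd))).
pose g (U : T) := 2 ^+ m * (2 ^+ m.-1 * (sqm (Z U s t) ^+ m + sqm (Z U t s) ^+ m)).
have bg : bmf g by apply/bmfZ/bmfZ/bmfD.
apply: (@le_trans _ _ (Ex H g)).
  apply: le_Ex => //.
    have [mf [M fM]] := bmfX m (bmf_sqm bd); split; last by exists M => U; exact: fM.
    exact: (measurableT_comp mf (measurable_unitary_mul V)).
  move=> U.
  have ZV : Z (unitary_mul V U) = pair_mx R s t *m Z U *m (pair_mx R s t)^t*.
    by rewrite /reduced conj_unitary_mul ptraceE_tens1.
  rewrite ZV pair_mx_conj_diff// sqmM.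
  have -> : sqm ('i%C : C) = 1 by rewrite /sqm/= expr0n expr1n add0r.
  rewrite mul1r; apply: (@le_trans _ _ ((2 * (sqm (Z U s t) + sqm (Z U t s))) ^+ m)).
    have h : sqm (Z U s t - Z U t s) <= 2 * (sqm (Z U s t) + sqm (Z U t s)).
      by rewrite -[sqm (Z U t s)]sqmN; exact: sqmD_le.
    by apply: lerXn2r (h); rewrite nnegrE ?sqm_ge0//; apply: le_trans h; exact: sqm_ge0.
  rewrite exprMn ler_wpM2l ?exprn_ge0//.
  have := @sum_exprn_le R bool
    (fun b => if b then sqm (Z U s t) else sqm (Z U t s)) m m0.
  by rewrite card_bool !big_bool/=; apply; case; exact: sqm_ge0.
rewrite ExZ; last by apply/bmfZ/bmfD.
rewrite ExZ; last by apply/bmfD.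
rewrite ExD//.
apply: (@le_trans _ _ (2 ^+ m *
    (2 ^+ m.-1 * (offdiag_bound R dS dE m + offdiag_bound R dS dE m)))).
  rewrite !ler_wpM2l ?exprn_ge0//; apply: lerD; apply: haar_offdiag_moment => //.
  by rewrite eq_sym.
set b := offdiag_bound _ _ _ _.
rewrite (_ : _ * _ = 2 ^+ m * 2 ^+ m.-1.+1 * b); last by rewrite [_ ^+ _.+1]exprS; ring.
by rewrite prednK// -exprMn -natrM.
Qed.

Lemma offdiag_bound_ge0 m : 0 <= offdiag_bound R dS dE m.
Proof.
by rewrite /offdiag_bound !mulr_ge0 ?khconst_ge0 ?exprn_ge0 ?invr_ge0 ?exprn_ge0.
Qed.

(** Since [Z] has trace 1, [Z s s - 1/dS] is the average over [t] of [Z s s - Z t t], and Jensen's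
    inequality applies. *)
Lemma haar_diag_moment s m : (0 < m)%N ->
  Ex H (fun U => sqm (Z U s s - dS%:R^-1%:C) ^+ m) <= 4 ^+ m * offdiag_bound R dS dE m.
Proof.
move=> m0.
have dS0 : dS%:R != 0 :> R by rewrite pnatr_eq0 -lt0n; case: dS s => [[]|].
have w0 (t : 'I_dS) : 0 <= dS%:R^-1 :> R by rewrite invr_ge0.
have w1 : \sum_(t < dS) dS%:R^-1 = 1 :> R.
  by rewrite sumr_const card_ord -[LHS]mulr_natl mulfV.
have bZ i j : cbm (fun U => Z U i j) := mxbm_reduced rho i j.
have bd t : bmf (fun U => sqm (Z U s s - Z U t t) ^+ m).
  by apply/bmfX/bmf_sqm/cbmD => //; exact: cbmN.
apply: (@le_trans _ _ (Ex H (fun U => \sum_t dS%:R^-1 * sqm (Z U s s - Z U t t) ^+ m))).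
  apply: le_Ex; [|by apply: bmf_sum => t; exact: bmfZ|].
    by apply/bmfX/bmf_sqm/cbmD => //; exact: cbm_cst.
  move=> U; apply: le_trans (sqm_jensen_exprn _ _ w0 w1).
  rewrite le_eqVlt; apply/orP; left; apply/eqP; congr (sqm _ ^+ _).
  have [_ trZ] := reduced_state rho_state U.
  rewrite -mulr_sumr sumrB -/(mxtrace _) trZ sumr_const card_ord mulrBr mulr1.
  congr (_ - _); rewrite -[Z U s s *+ dS]mulr_natl mulrA.
  by rewrite -(rmorph_nat (real_complex R)) -rmorphM/= mulVf// mul1r.
rewrite Ex_sum; last by move=> t; exact: bmfZ.
rewrite [leRHS](_ : _ =
  \sum_(t < dS) dS%:R^-1 * (4 ^+ m * offdiag_bound R dS dE m)); last first.
  by rewrite -mulr_suml w1 mul1r.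
apply: ler_sum => t _; rewrite ExZ// ler_wpM2l//.
have [<-|st] := eqVneq s t; last exact: haar_diag_diff_moment.
under eq_fun do rewrite subrr sqm_real (expr0n _ 2) expr0n.
rewrite Ex_cst eqn0Ngt m0/= mulr_ge0 ?offdiag_bound_ge0//.
Qed.

Definition purity n (A : 'M[C]_n) : R := \sum_s \sum_t sqm (A s t).

(* [d_S] times the squared Hilbert-Schmidt distance to the maximally mixed
   state, see [excessE]. *)
Definition excess (U : T) : R := dS%:R * purity (Z U) - 1.

(** When the squares are expanded, trace 1 makes the cross terms sum to [-2/dS] and the constants to
    [1/dS]. This form shows nonnegativity and allows an entrywise bound. *)
Lemma excessE U : (0 < dS)%N ->
  excess U = dS%:R * \sum_(st : 'I_dS * 'I_dS)
    sqm (Z U st.1 st.2 - ((st.1 == st.2)%:R / dS%:R)%:C).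
Proof.
move=> dSgt0; have dS0 : dS%:R != 0 :> R by rewrite pnatr_eq0 -lt0n.
have [_ trZ] := reduced_state rho_state U.
have sE (z : C) (a : R) : sqm (z - a%:C) = sqm z - 2 * a * complex.Re z + a ^+ 2.
  by case: z => x y; rewrite /sqm/=; ring.
rewrite -(pair_bigA _ (fun s t => sqm (Z U s t - ((s == t)%:R / dS%:R)%:C)))/=.
have -> : \sum_s \sum_t sqm (Z U s t - ((s == t)%:R / dS%:R)%:C) =
    \sum_s (\sum_t sqm (Z U s t) - 2 / dS%:R * complex.Re (Z U s s) + dS%:R^-1 ^+ 2).
  apply: eq_bigr => s _; rewrite (bigD1 s)//= [X in _ = X - _ + _](bigD1 s)//= sE eqxx.
  rewrite mul1r (eq_bigr (fun t => sqm (Z U s t))); first by ring.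
  by move=> t; rewrite eq_sym => /negPf ->; rewrite mul0r subr0.
rewrite big_split/= sumrB -mulr_sumr sumr_const card_ord -Re_sum -/(mxtrace _) trZ/=.
by rewrite /excess -/(purity _) -[_ ^+ 2 *+ dS]mulr_natl; field.
Qed.

Lemma bmf_excess : bmf excess.
Proof.
apply: bmfB; last exact: bmf_cst.
apply/bmfZ; apply: bmf_sum => s; apply: bmf_sum => t; apply: bmf_sqm.
exact: mxbm_reduced.
Qed.

Lemma excess_ge0 U : (0 < dS)%N -> 0 <= excess U.
Proof.
by move=> h; rewrite excessE// mulr_ge0// sumr_ge0// => i _; exact: sqm_ge0.
Qed.

(** In [dS^(3m)], [dS^m] is the prefactor of the excess and [dS^(2m)] comes from the power mean over
    [dS^2] entries. *)
Lemma haar_excess_moment m : (0 < m)%N -> (0 < dS)%N ->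
  Ex H (fun U => excess U ^+ m) <=
  dS%:R ^+ (3 * m) * (4 ^+ m * offdiag_bound R dS dE m).
Proof.
move=> m0 dS0.
have bZ i j : cbm (fun U => Z U i j) := mxbm_reduced rho i j.
pose y (st : 'I_dS * 'I_dS) (U : T) :=
  sqm (Z U st.1 st.2 - ((st.1 == st.2)%:R / dS%:R)%:C).
have by_ st : bmf (y st).
  by apply/bmf_sqm/cbmD => //; exact: cbm_cst.
have bX := bmf_excess.
pose g U := (dS ^ m)%:R * ((dS * dS)%:R ^+ m.-1 * \sum_st y st U ^+ m).
have bs : bmf (fun U => \sum_st y st U ^+ m).
  by apply: bmf_sum => st; exact: bmfX.
have bg : bmf g by apply/bmfZ/bmfZ.
apply: (@le_trans _ _ (Ex H g)).
  apply: le_Ex => //; first exact: bmfX.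
  move=> U; rewrite /g excessE// exprMn natrX ler_wpM2l ?exprn_ge0//.
  have := @sum_exprn_le R _ (fun st => y st U) m m0.
  by rewrite card_prod card_ord; apply=> st; exact: sqm_ge0.
rewrite ExZ; last exact: bmfZ.
rewrite ExZ// Ex_sum; last by move=> st; exact: bmfX.
apply: (@le_trans _ _ ((dS ^ m)%:R * ((dS * dS)%:R ^+ m.-1 *
    \sum_(st : 'I_dS * 'I_dS) (4 ^+ m * offdiag_bound R dS dE m)))).
  rewrite !ler_wpM2l ?exprn_ge0//; apply: ler_sum => -[s t] _; rewrite /y/=.
  have [<-|st] := eqVneq s t; first by rewrite mul1r; exact: haar_diag_moment.
  under eq_fun do rewrite mul0r subr0.
  apply: le_trans (haar_offdiag_moment hH d1 rho_state st m0) _.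
  by rewrite ler_peMl ?offdiag_bound_ge0// exprn_ege1// ler1n.
move: (offdiag_bound _ _ _ _) => b.
rewrite sumr_const card_prod card_ord -[(4 ^+ m * _) *+ _]mulr_natl !mulrA.
rewrite le_eqVlt; apply/orP; left; apply/eqP; congr (_ * _ * _).
rewrite -mulrA -exprSr prednK// natrX natrM exprMn mulrA -!exprD; congr (_ ^+ _).
by lia.
Qed.

End ReducedMoments.

(** * Balanced polynomials and designs *)

Local Notation normc := Normc.normc.

Section BalancedPolynomials.
Context (R : realType) (d : nat).
Local Notation C := R[i].
Local Notation T := (unitaryGroup R d).
Local Notation idx := ('I_d * 'I_d)%type.
Implicit Types (f g : T -> C) (c : R) (j : nat).

(** With lists of positions instead of families indexed by ['I_j], multiplying monomials is
    concatenation. *)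
Definition mono (t : seq idx * seq idx) (U : T) : C :=
  (\prod_(x <- t.1) val U x.1 x.2) * \prod_(x <- t.2) (val U x.1 x.2)^*%C.

Lemma cbm_mono t : cbm (mono t).
Proof.
by apply: cbmM; apply: cbm_prod => x; [|apply: cbm_conj]; exact: mxbm_val.
Qed.

Lemma mono_balanced_monomial t : size t.1 = size t.2 ->
  exists p q : 'I_(size t.1) -> idx, mono t = balanced_monomial p q.
Proof.
case: t => t1 t2 /= e12; pose t2' := Tuple (introT eqP (esym e12)).
exists (tnth (in_tuple t1)), (tnth t2'); apply/funext => U.
by rewrite /mono/= -[t1]/(val (in_tuple t1)) big_tuple -[t2]/(val t2') big_tuple.
Qed.

(* [c] bounds the sum of the absolute values of the coefficients. *)
Definition bal j c f := exists s : seq (C * (seq idx * seq idx)),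
  [/\ all (fun t => (size t.2.1 == size t.2.2) && (size t.2.1 <= j)%N) s,
      \sum_(t <- s) normc t.1 <= c &
      forall U, f U = \sum_(t <- s) t.1 * mono t.2 U].

Lemma normc_ge0 (z : C) : 0 <= normc z.
Proof. by case: z => a b; exact: sqrtr_ge0. Qed.

Lemma normc_sqm (z : C) : normc z = Num.sqrt (sqm z).
Proof. by case: z. Qed.

Lemma bal_weaken j j' c c' f : (j <= j')%N -> c <= c' -> bal j c f -> bal j' c' f.
Proof.
move=> jj' cc' [s [/allP h1 h2 h3]]; exists s; split=> //; last exact: le_trans cc'.
by apply/allP => t /h1/andP[-> /leq_trans->].
Qed.

Lemma bal_cst (z : C) : bal 0 (normc z) (fun=> z).
Proof.
exists [:: (z, ([::], [::]))]; split=> //; rewrite ?big_seq1// => U.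
by rewrite big_seq1 /mono/= !big_nil !mulr1.
Qed.

Lemma balD j c c' f g : bal j c f -> bal j c' g -> bal j (c + c') (fun U => f U + g U).
Proof.
move=> [s [h1 h2 h3]] [s' [h1' h2' h3']]; exists (s ++ s'); split.
- by rewrite all_cat h1.
- by rewrite big_cat lerD.
- by move=> U; rewrite big_cat/= h3 h3'.
Qed.

Lemma balM j j' c c' f g : bal j c f -> bal j' c' g ->
  bal (j + j') (c * c') (fun U => f U * g U).
Proof.
move=> [s [/allP h1 h2 h3]] [s' [/allP h1' h2' h3']].
pose m (x y : C * (seq idx * seq idx)) :=
  (x.1 * y.1, (x.2.1 ++ y.2.1, x.2.2 ++ y.2.2)).
exists [seq m x y | x <- s, y <- s']; split.
- apply/allP => _ /allpairsP[[x y] /= [xs ys ->]] /=.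
  have /andP[/eqP x1 x2] := h1 _ xs; have /andP[/eqP y1 y2] := h1' _ ys.
  by rewrite !size_cat x1 y1 eqxx -x1 -y1 leq_add.
- rewrite big_allpairs_dep/=.
  under eq_bigr do under eq_bigr do rewrite Normc.normcM.
  under eq_bigr do rewrite -mulr_sumr.
  rewrite -mulr_suml ler_pM// ?sumr_ge0// => *; exact: normc_ge0.
- move=> U; rewrite big_allpairs_dep h3 h3' mulr_suml; apply: eq_bigr => x _.
  rewrite mulr_sumr; apply: eq_bigr => y _.
  by rewrite /mono/= !big_cat/= mulrACA; congr (_ * _); rewrite mulrACA.
Qed.

Lemma bal_conj j c f : bal j c f -> bal j c (fun U => (f U)^*%C).
Proof.
move=> [s [/allP h1 h2 h3]].
exists [seq (t.1^*%C, (t.2.2, t.2.1)) | t <- s]; split.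
- by apply/allP => _ /mapP[t /h1/andP[/eqP e le] ->] /=; rewrite e eqxx -e.
- rewrite big_map/=; apply: le_trans h2; rewrite le_eqVlt; apply/orP; left; apply/eqP.
  by apply: eq_bigr => t _; rewrite !normc_sqm sqm_conj.
- move=> U; rewrite h3 conjc_sum big_map; apply: eq_bigr => t _.
  rewrite /mono/= !conjcM !conjc_prod; congr (_ * _); rewrite mulrC.
  by congr (_ * _); apply: eq_bigr => x _; rewrite conjcK.
Qed.

Lemma bal_entries i a k b : bal 1 1 (fun U => val U i a * (val U k b)^*%C).
Proof.
exists [:: (1, ([:: (i, a)], [:: (k, b)]))]; split=> //.
  by rewrite big_seq1 Normc.normc1.
by move=> U; rewrite big_seq1 /mono/= !big_seq1 mul1r.
Qed.

Lemma bal_sum (I : finType) j (c : I -> R) (F : I -> T -> C) :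
  (forall i, bal j (c i) (F i)) -> bal j (\sum_i c i) (fun U => \sum_i F i U).
Proof.
move=> bF; elim: (index_enum I) => [|i r IHr].
  rewrite big_nil; under eq_fun do rewrite big_nil.
  by exists [::]; split=> [||U]; rewrite ?big_nil.
rewrite (_ : (fun U => _) = fun U => F i U + \sum_(k <- r) F k U).
  by rewrite big_cons; exact: balD.
by apply/funext => U; rewrite big_cons.
Qed.

Lemma balX j c f n : bal j c f -> bal (n * j) (c ^+ n) (fun U => f U ^+ n).
Proof.
move=> bf; elim: n => [|n IHn].
  by have := bal_cst 1; rewrite Normc.normc1.
by under eq_fun do rewrite exprS; rewrite exprS mulSn; exact: balM.
Qed.

Implicit Type P : probability T R.

Lemma cexpectationE P f :
  cexpectation P f =
  Ex P (fun U => complex.Re (f U)) +i* Ex P (fun U => complex.Im (f U)).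
Proof. by []. Qed.

Lemma cexpectationD P f g : cbm f -> cbm g ->
  cexpectation P (fun U => f U + g U) = cexpectation P f + cexpectation P g.
Proof.
move=> [f1 f2] [g1 g2]; rewrite !cexpectationE.
under [in X in X +i* _]eq_fun do rewrite ReD.
under [in X in _ +i* X]eq_fun do rewrite ImD.
by rewrite !ExD.
Qed.

Lemma cexpectationZ P (z : C) f : cbm f ->
  cexpectation P (fun U => z * f U) = z * cexpectation P f.
Proof.
move=> [f1 f2]; rewrite !cexpectationE; case: z => a b.
have -> : (fun U => complex.Re ((a +i* b) * f U)) =
    fun U => a * complex.Re (f U) - b * complex.Im (f U).
  by apply/funext => U; case: (f U).
have -> : (fun U => complex.Im ((a +i* b) * f U)) =
    fun U => a * complex.Im (f U) + b * complex.Re (f U).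
  by apply/funext => U; case: (f U).
by rewrite ExB ?ExD ?ExZ//; exact: bmfZ.
Qed.

Lemma cexpectation_poly P (s : seq (C * (seq idx * seq idx))) :
  cexpectation P (fun U => \sum_(t <- s) t.1 * mono t.2 U) =
  \sum_(t <- s) t.1 * cexpectation P (mono t.2).
Proof.
have bt (t : C * (seq idx * seq idx)) : cbm (fun U => t.1 * mono t.2 U).
  by apply: cbmM; [exact: cbm_cst | exact: cbm_mono].
elim: s => [|t s IHs].
  under eq_fun do rewrite big_nil.
  by rewrite big_nil cexpectationE/= !Ex_cst.
under eq_fun do rewrite big_cons.
rewrite cexpectationD//; last exact: cbm_sum.
by rewrite big_cons IHs cexpectationZ//; exact: cbm_mono.
Qed.

Lemma design_bal (H nu : probability T R) eps k j c f :
  approx_unitary_design H nu eps k -> (j <= k)%N -> 0 <= eps -> bal j c f ->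
  normc (cexpectation nu f - cexpectation H f) <= c * (eps / d%:R ^+ k).
Proof.
move=> des jk eps0 [s [/allP h1 h2 h3]].
have -> : f = fun U => \sum_(t <- s) t.1 * mono t.2 U by apply/funext.
rewrite !cexpectation_poly -sumrB.
have e0 : 0 <= eps / d%:R ^+ k by rewrite divr_ge0 ?exprn_ge0.
apply: le_trans (ler_wpM2r e0 h2); rewrite mulr_suml big_seq [leRHS]big_seq.
apply: (big_ind2 (fun (z : C) (a : R) => normc z <= a)) => [|z a w b za wb|t ts].
- by rewrite Normc.normc0.
- exact: le_trans (le_normcD _ _) (lerD za wb).
rewrite -mulrBr Normc.normcM ler_wpM2l ?normc_ge0//.
have /andP[/eqP e le] := h1 _ ts; have [p [q ->]] := mono_balanced_monomial e.
by rewrite -lecR; exact: des (leq_trans le jk).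
Qed.

Lemma design_real (H nu : probability T R) eps k j c (f : T -> R) :
  approx_unitary_design H nu eps k -> (j <= k)%N -> 0 <= eps ->
  bal j c (fun U => (f U)%:C) -> Ex nu f <= Ex H f + c * (eps / d%:R ^+ k).
Proof.
move=> des jk e0 bf; have := design_bal des jk e0 bf.
have e P : cexpectation P (fun U => (f U)%:C) = (Ex P f)%:C.
  by rewrite cexpectationE/= Ex_cst.
rewrite !e -rmorphB normc_sqm sqm_real sqrtr_sqr => /(le_trans (ler_norm _)).
by rewrite lerBlDl.
Qed.

End BalancedPolynomials.

(** * Degree and size of the coefficients of the excess *)

Section ExcessPolynomial.
Context (R : realType) (dS dE : nat).
Local Notation C := R[i].
Local Notation d := (dS * dE)%N.
Local Notation T := (unitaryGroup R d).
Variable rho : 'M[C]_d.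
Hypothesis rho_state : is_state rho.

Lemma state_entry_normc n (A : 'M[C]_n) i j : is_state A -> normc (A i j) <= 1.
Proof.
move=> sA; have [AE l0 l1] := state_spectral sA.
have uQ : (spectralmx A)^t* \is unitarymx.
  by rewrite trmxC_unitary; exact: spectral_unitarymx.
rewrite normc_sqm -[leRHS]sqrtr1 ler_sqrt// AE hermdecE.
apply: le_trans (sqm_jensen _ l0 l1) _; rewrite -l1; apply: ler_sum => k _.
rewrite -[leRHS]mulr1 ler_wpM2l// sqmM sqm_conj mulr_ile1 ?sqm_ge0//.
  exact: unitary_sqm_le1.
exact: unitary_sqm_le1.
Qed.

Lemma bal_reduced s t : bal 1 (d%:R ^+ 3) (fun U => reduced rho U s t).
Proof.
have RE U : reduced rho U s t = \sum_e \sum_b \sum_a rho a b *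
   (val U (mxtens_index (s, e)) a * (val U (mxtens_index (t, e)) b)^*%C).
  rewrite mxE; apply: eq_bigr => e _; rewrite mxE; apply: eq_bigr => b _.
  rewrite mxE mulr_suml; apply: eq_bigr => a _.
  by rewrite trmxCE mulrAC mulrC.
under eq_fun do rewrite RE.
have h : \sum_(e < dE) \sum_(b < d) \sum_(a < d) (1 : R) <= d%:R ^+ 3.
  have le : (dE <= d)%N by rewrite leq_pmull//; exact: leq_ltn_trans (ltn_ord s).
  rewrite !sumr_const !card_ord -!mulrnA -natrX ler_nat (expnSr _ 2) -mulnn.
  by rewrite -[leqRHS]mulnA !leq_mul.
apply: (bal_weaken (leqnn 1) h).
apply: bal_sum => e; apply: bal_sum => b; apply: bal_sum => a.
have := balM (bal_cst _ (rho a b))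
  (bal_entries _ (mxtens_index (s, e)) a (mxtens_index (t, e)) b).
apply: bal_weaken; rewrite ?mulr1//.
exact: state_entry_normc.
Qed.

(** The coefficients are counted crudely: [dS * dS^2 * (d^3)^2 + 1 <= d^9 + 1 <= d^10]. This is
    harmless, as the design error [4^(-n^2)] equals [d^(-2n)] while the [m]-th power costs [d^(10m)]
    with [16 m <= n]. *)
Lemma bal_excess : (1 < d)%N -> bal 2 (d%:R ^+ 10) (fun U => (excess rho U)%:C).
Proof.
move=> d1.
have XE U : (excess rho U)%:C = dS%:R%:C *
   (\sum_s \sum_t reduced rho U s t * (reduced rho U s t)^*%C) + (-1)%:C.
  rewrite /excess rmorphB rmorphM/= rmorph_sum rmorphN; congr (_ * _ - _).
  apply: eq_bigr => s _; rewrite rmorph_sum; apply: eq_bigr => t _.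
  by rewrite sqmE.
under eq_fun do rewrite XE.
have h : normc (dS%:R%:C : C) * (\sum_(s < dS) \sum_(t < dS) d%:R ^+ 3 * d%:R ^+ 3) +
    normc ((-1)%:C : C) <= d%:R ^+ 10.
  rewrite !normc_sqm !sqm_real !sqrtr_sqr normrN1 normr_nat.
  rewrite -exprD !sumr_const card_ord -mulrnA -[d%:R ^+ _ *+ _]mulr_natl.
  rewrite -!natrX -!natrM natr1 ler_nat -addn1.
  have le : (dS <= d)%N by rewrite leq_pmulr//; case: dE d1 => //; rewrite muln0.
  apply: (@leq_trans (d * (d * d * d ^ 6) + 1)).
    by rewrite leq_add2r !leq_mul.
  rewrite addn1.
  have e x : (x * (x * x * x ^ 6) = x ^ 9)%N by rewrite !expnS !mulnA.
  rewrite e.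
  apply: (@leq_trans (2 * d ^ 9)); last by rewrite [(d ^ 10)%N]expnS leq_mul2r d1 orbT.
  by rewrite mul2n -addnn -addn1 leq_add2l expn_gt0; lia.
apply: (bal_weaken (leqnn 2) h); apply: balD; last exact: bal_weaken (bal_cst _ _).
apply: (balM (j := 0)); first exact: bal_cst.
apply: bal_sum => s; apply: bal_sum => t; apply: (balM (j := 1) (j' := 1)).
  exact: bal_reduced.
exact/bal_conj/bal_reduced.
Qed.

End ExcessPolynomial.

(** * Entropy *)

Section LogSeries.
Context (R : realType).

Definition ln_partial (N : nat) (x : R) : R := \sum_(j < N) (1 - x) ^+ j.+1 / j.+1%:R.

Lemma is_derive_ln_partial N (x : R) :
  is_derive x 1 (ln_partial N) (- \sum_(j < N) (1 - x) ^+ j).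
Proof.
elim: N => [|N IHN].
  have -> : ln_partial 0 = cst 0 by apply/funext => y; rewrite /ln_partial big_ord0.
  by rewrite big_ord0 oppr0; exact: is_derive_cst.
have -> : ln_partial N.+1 =
    ln_partial N + (N.+1%:R^-1 \*: ((cst 1 - id : R -> R) ^+ N.+1)).
  apply/funext => y; rewrite /ln_partial big_ord_recr/=; congr (_ + _).
  by rewrite [RHS]mulrC !fctE.
have h1 : is_derive x 1 (cst 1 - id : R -> R) (0 - 1).
  by apply: is_deriveB; exact: is_derive_cst || exact: is_derive_id.
have h2 := is_deriveZ (N.+1%:R^-1) (is_deriveX N.+1 h1).
apply: is_derive_eq (is_deriveD IHN h2) _.
rewrite big_ord_recr/= opprD; congr (_ + _).
rewrite sub0r /GRing.scale/=.
by rewrite mulrN1 !mulrN mulrA mulVf ?mul1r// pnatr_eq0.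
Qed.

(** The remainder vanishes at 1 and, by the geometric sum, has derivative [-(1-y)^N / y]; the mean
    value theorem on [[x, 1]] gives the bound. *)
Lemma ln_partial_bound N (x : R) : 0 < x -> x <= 1 ->
  `|- ln x - ln_partial N x| <= (1 - x) ^+ N / x.
Proof.
move=> x0; rewrite le_eqVlt => /predU1P[->|x1].
  rewrite ln1 oppr0 sub0r normrN (_ : ln_partial N 1 = 0).
    by rewrite normr0 subrr divr1 exprn_ge0.
  by rewrite /ln_partial big1// => j _; rewrite subrr expr0n mul0r.
pose F (y : R) := - ln y - ln_partial N y.
have dF (y : R) : 0 < y -> is_derive y 1 F (- y^-1 + \sum_(j < N) (1 - y) ^+ j).
  move=> y0; have hl := is_derive1_ln y0.
  have hp := is_derive_ln_partial N y.
  have -> : F = (- (@ln R : R -> R)) - ln_partial N by [].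
  by apply: is_derive_eq (is_deriveB (is_deriveN hl) hp) _; rewrite opprK.
have cF : {within `[x, 1], continuous F}.
  apply: derivable_within_continuous => y; rewrite in_itv/= => /andP[xy _].
  by apply: ex_derive; apply: dF; exact: lt_le_trans xy.
have dF' (y : R) : y \in `]x, 1[ ->
    is_derive y 1 F (- y^-1 + \sum_(j < N) (1 - y) ^+ j).
  by rewrite in_itv/= => /andP[xy _]; apply: dF; exact: lt_trans xy.
have [c] := MVT x1 dF' cF.
rewrite in_itv/= => /andP[xc c1] e.
have F1 : F 1 = 0.
  rewrite /F ln1 oppr0 sub0r /ln_partial big1 ?oppr0// => j _.
  by rewrite subrr expr0n mul0r.
have c0 : 0 < c := lt_trans x0 xc.
have geom : - c^-1 + \sum_(j < N) (1 - c) ^+ j = - ((1 - c) ^+ N / c).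
  have := subrX1 (1 - c) N; set S := \sum_(_ < _) _.
  rewrite (_ : 1 - c - 1 = - c); last by ring.
  move=> h; have -> : (1 - c) ^+ N = 1 - c * S by rewrite -[LHS](subrK 1) h; ring.
  by field; rewrite gt_eqF.
move: e; rewrite F1 sub0r geom => /eqP; rewrite mulNr eqr_opp => /eqP.
rewrite -/(F x) => ->.
have c1' : 0 <= 1 - c by rewrite subr_ge0 ltW.
have x1' : 0 <= 1 - x by rewrite subr_ge0 ltW.
rewrite ger0_norm ?mulr_ge0 ?invr_ge0 ?exprn_ge0 ?(ltW c0)//.
apply: (@le_trans _ _ ((1 - c) ^+ N / c)).
  by rewrite -[leRHS]mulr1 ler_wpM2l ?mulr_ge0 ?invr_ge0 ?exprn_ge0 ?(ltW c0)//; lra.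
rewrite ler_pM ?exprn_ge0 ?invr_ge0 ?(ltW c0)//.
  by rewrite lerXn2r ?nnegrE//; lra.
by rewrite lef_pV2 ?posrE// ltW.
Qed.

(** The factor [x] is what saves the case [x = 0], where [ln_partial] is the divergent harmonic
    sum. *)
Lemma cvg_ln_partial (x : R) : 0 <= x -> x <= 1 ->
  (fun N => x * ln_partial N x) @ \oo --> - (x * ln x).
Proof.
rewrite le_eqVlt => /predU1P[<- _|x0 x1].
  by rewrite mul0r oppr0; under eq_fun do rewrite mul0r; exact: cvg_cst.
rewrite -mulrN; apply: cvgMr.
apply/cvgrPdist_le => e e0.
have xx : `|1 - x| < 1 by rewrite ger0_norm; lra.
have /cvgrPdist_le/(_ (e * x) (mulr_gt0 e0 x0)) := cvg_expr xx.
apply: filterS => N; rewrite sub0r normrN ger0_norm ?exprn_ge0 ?subr_ge0// => h.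
by apply: le_trans (ln_partial_bound N x0 x1) _; rewrite ler_pdivrMr.
Qed.

End LogSeries.

Section Entropy.
Context (R : realType).
Local Notation C := R[i].

Lemma hermdec_mul n (a b : 'I_n -> R) (P : 'M[C]_n) : P \is unitarymx ->
  hermdec a (P^t*) *m hermdec b (P^t*) = hermdec (fun k => a k * b k) (P^t*).
Proof.
move=> /unitarymxP PP; rewrite /hermdec trmxCK -!mulmxA (mulmxA P) PP mul1mx.
rewrite [X in _ *m X]mulmxA mulmx_diag; congr (_ *m (diag_mx _ *m _)).
by apply/rowP => k; rewrite !mxE rmorphM.
Qed.

Lemma hermdec_tr n (a : 'I_n -> R) (P : 'M[C]_n) : P \is unitarymx ->
  \tr (hermdec a (P^t*)) = (\sum_k a k)%:C.
Proof.
move=> /unitarymxP PP; rewrite /hermdec trmxCK mxtrace_mulC mulmxA PP mul1mx.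
by rewrite mxtrace_diag rmorph_sum; apply: eq_bigr => k _; rewrite mxE.
Qed.

Lemma hermdec1 n (P : 'M[C]_n) : P \is unitarymx -> hermdec (fun=> 1) (P^t*) = 1%:M.
Proof.
move=> uP; rewrite /hermdec trmxCK (_ : \row__ _ = const_mx 1); last first.
  by apply/rowP => k; rewrite !mxE.
rewrite diag_const_mx mulmx1; move: uP; rewrite -trmxC_unitary => /unitarymxP.
by rewrite trmxCK.
Qed.

Lemma hermdecB n (a b : 'I_n -> R) (Q : 'M[C]_n) :
  hermdec a Q - hermdec b Q = hermdec (fun k => a k - b k) Q.
Proof.
apply/matrixP => i j; rewrite [LHS]mxE [X in _ + X]mxE !hermdecE -sumrB.
by apply: eq_bigr => k _; rewrite -mulrBl -rmorphB.
Qed.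

Variables (n : nat) (A : 'M[C]_n).
Hypothesis sA : is_state A.
Local Notation l := (eigval A).

Lemma eigval_le1 k : l k <= 1.
Proof.
have [_ l0 <-] := state_spectral sA; rewrite (bigD1 k)//= lerDl.
by apply: sumr_ge0 => j _; exact: l0.
Qed.

Lemma herm_funE f : herm_fun f A = hermdec (fun k => f (l k)) ((spectralmx A)^t*).
Proof.
rewrite /herm_fun (invmx_unitary (spectral_unitarymx A)) /hermdec trmxCK.
by congr (_ *m diag_mx _ *m _); apply/rowP => k; rewrite !mxE.
Qed.

Lemma vn_entropyE : vn_entropy A = - \sum_k l k * log2 (l k).
Proof.
have [AE _ _] := state_spectral sA.
have uP := spectral_unitarymx A.
by rewrite /vn_entropy herm_funE {1}AE (hermdec_mul _ _ uP) (hermdec_tr _ uP).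
Qed.

Lemma purityE : purity A = \sum_k l k ^+ 2.
Proof.
have [AE _ _] := state_spectral sA; have uP := spectral_unitarymx A.
apply: (@complexI R); under [in RHS]eq_bigr do rewrite expr2.
have hA : A^t* = A by rewrite {1}AE hermdec_herm -AE.
rewrite -(hermdec_tr (fun k => l k * l k) uP) -(hermdec_mul l l uP) -AE.
rewrite -[X in \tr (_ *m X)]hA.
rewrite /purity rmorph_sum /mxtrace; apply: eq_bigr => s _.
rewrite rmorph_sum mxE; apply: eq_bigr => t _.
by rewrite trmxCE sqmE.
Qed.

Lemma purity_gt0 : 0 < purity A.
Proof.
rewrite purityE; have [_ l0 l1] := state_spectral sA.
rewrite lt_neqAle sumr_ge0 ?andbT => [|k _]; last exact: sqr_ge0.
apply/eqP => /esym/eqP; rewrite psumr_eq0 => [/allP h|k _]; last exact: sqr_ge0.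
have : (0 : R) = 1; last by move/eqP; rewrite eq_sym oner_eq0.
rewrite -l1 big1// => k _; apply/eqP.
by have := h k (mem_index_enum _); rewrite sqrf_eq0.
Qed.

Lemma purity_le1 : purity A <= 1.
Proof.
rewrite purityE; have [_ l0 l1] := state_spectral sA.
rewrite -[leRHS]l1; apply: ler_sum => k _.
by rewrite expr2 ler_piMr// eigval_le1.
Qed.

(* Renyi-2 lower bound: [ln x <= x / p - 1 + ln p] at [p = purity A]. *)
Lemma entropy_ge_purity : - log2 (purity A) <= vn_entropy A.
Proof.
have p0 := purity_gt0; have [_ l0 l1] := state_spectral sA.
rewrite vn_entropyE lerN2 /log2.
under eq_bigr do rewrite mulrA.
rewrite -mulr_suml ler_pM2r ?invr_gt0 ?ln_gt0 ?ltr1n//.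
apply: (@le_trans _ _ (\sum_k (l k ^+ 2 / purity A + l k * (ln (purity A) - 1)))).
  apply: ler_sum => k _; have := l0 k; rewrite le_eqVlt => /predU1P[<-|lk].
    by rewrite expr0n !mul0r addr0.
  rewrite expr2 -mulrA -mulrDr ler_wpM2l//.
  have := @le_ln1Dx R (l k / purity A - 1).
  rewrite ltrBrDl subrr divr_gt0// => /(_ isT).
  rewrite addrC subrK lnM ?posrE ?invr_gt0//.
  by rewrite lnV ?posrE//; lra.
rewrite big_split/= -!mulr_suml l1 -purityE mulfV ?gt_eqF//; lra.
Qed.

(** The truncated logarithmic series of [- x log2 x] at the matrix [B]: [iter] builds
    [(1-B)^(j+1) B], so only polynomials in the entries appear, and no eigenvalues. *)
Definition entropy_partial (N : nat) (B : 'M[C]_n) : R :=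
  (\sum_(j < N) complex.Re (\tr (iter j.+1 (mulmx (1%:M - B)) B)) / j.+1%:R) / ln 2.

Lemma cvg_entropy_partial : (fun N => entropy_partial N A) @ \oo --> vn_entropy A.
Proof.
have [AE l0 l1] := state_spectral sA; have uP := spectral_unitarymx A.
have iE j : iter j (mulmx (1%:M - A)) A =
    hermdec (fun k => (1 - l k) ^+ j * l k) ((spectralmx A)^t*).
  elim: j => [|j IHj] /=; first by under eq_fun do rewrite expr0 mul1r.
  rewrite IHj; have -> : 1%:M - A = hermdec (fun k => 1 - l k) ((spectralmx A)^t*).
    by rewrite -(hermdec1 uP) [X in _ - X]AE hermdecB.
  rewrite (hermdec_mul _ _ uP).
  by congr hermdec; apply/funext => k; rewrite exprS mulrA.
have -> : (fun N => entropy_partial N A) =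
    fun N => (\sum_k l k * ln_partial N (l k)) / ln 2.
  apply/funext => N; rewrite /entropy_partial; congr (_ / _).
  under eq_bigr do rewrite iE hermdec_tr//= mulr_suml.
  rewrite exchange_big/=; apply: eq_bigr => k _.
  rewrite /ln_partial mulr_sumr; apply: eq_bigr => j _.
  by rewrite mulrAC mulrC.
have -> : vn_entropy A = (\sum_k - (l k * ln (l k))) / ln 2.
  rewrite vn_entropyE sumrN mulNr; congr (- _); rewrite mulr_suml.
  by apply: eq_bigr => k _; rewrite mulrA.
apply: cvgMl.
apply: cvg_big => [|k _]; first exact: add_continuous.
by apply: cvg_ln_partial => //; exact: eigval_le1.
Qed.

End Entropy.

(* A measure is unconstrained on non-measurable sets and [spectral_diag] is
   defined by choice, so measurability is obtained from the traces of polynomials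
   in [F x] that approximate the entropy pointwise. *)
Lemma measurable_entropy d (T : measurableType d) (R : realType) n
  (F : T -> 'M[R[i]]_n) : mxbm F -> (forall x, is_state (F x)) ->
  measurable_fun setT (fun x => vn_entropy (F x)).
Proof.
move=> bF sF; apply: (measurable_fun_cvg (h := fun N x => entropy_partial N (F x))).
  move=> N; have : bmf (fun x => entropy_partial N (F x)); last by case.
  rewrite /entropy_partial; under eq_fun do rewrite mulrC.
  apply: bmfZ; apply: bmf_sum => j; under eq_fun do rewrite mulrC.
  apply: bmfZ.
  have : cbm (fun x => \tr (iter j.+1 (mulmx (1%:M - F x)) (F x))); last by case.
  apply: cbm_tr; elim: (j.+1 : nat) => [|i IHi]//=.
  by apply: mxbmM => //; apply: mxbmB => //; exact: mxbm_cst.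
by move=> x _; exact: cvg_entropy_partial.
Qed.

(** * Numerical estimates *)

Section Numerics.
Context (R : realType).
Implicit Types (n m k : nat) (x y : R).

Lemma ln2_gt0 : 0 < ln 2 :> R. Proof. by rewrite ln_gt0// ltr1n. Qed.

Lemma log2X j : log2 ((2 ^ j)%:R : R) = j%:R.
Proof.
by rewrite /log2 natrX lnXn// -[_ *+ j]mulr_natl mulfK// gt_eqF// ln2_gt0.
Qed.

Lemma le_log2 x y : 0 < x -> x <= y -> log2 x <= log2 y.
Proof.
move=> x0 xy; rewrite /log2 ler_pM2r ?invr_gt0 ?ln2_gt0// ler_ln ?posrE//.
exact: lt_le_trans xy.
Qed.

Lemma log2_nat_ge j n : (2 ^ j <= n)%N -> j%:R <= log2 (n%:R : R).
Proof.
move=> h; rewrite -(log2X j).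
by apply: le_log2; rewrite ?ltr0n ?expn_gt0// ler_nat.
Qed.

Lemma powR2_log2 x y : 0 < x -> y <= log2 x -> 2 `^ y <= x.
Proof.
move=> x0; rewrite /log2 ler_pdivlMr ?ln2_gt0// => h.
by rewrite /powR pnatr_eq0/= -[leRHS]lnK ?posrE// ler_expR.
Qed.

(** The base case is [64^10 = 2^60]. For the step, Bernoulli gives
    [(n/(n+1))^10 >= 1 - 10/(n+1) >= 1/2], as [n + 1 >= 20]. *)
Lemma exp10_lt_exp2 n : (64 <= n)%N -> (n%:R : R) ^+ 10 < 2 ^+ n.
Proof.
elim: n => // n IHn; rewrite leq_eqVlt => /predU1P[<-|].
  by rewrite (_ : 64 = 2 ^+ 6) -?exprM ?ltr_eXn2l// ?ltr1n//; ring.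
rewrite ltnS => n64; have {}IHn := IHn n64; rewrite [2 ^+ _]exprS.
have n0 : 0 < (n.+1%:R : R) by rewrite ltr0n.
have y0 : 0 <= n%:R / (n.+1%:R : R) by rewrite divr_ge0.
have := exprn_tangent 10 (@ler01 R) y0.
rewrite !expr1n mulr1 expr_div_n.
have -> : n%:R / n.+1%:R - 1 = - n.+1%:R^-1 :> R.
  by apply/eqP; rewrite subr_eq -natr1; apply/eqP; field; rewrite natr1 gt_eqF.
rewrite ler_pdivlMr ?exprn_gt0// => h.
have i20 : n.+1%:R^-1 <= 20^-1 :> R by rewrite lef_pV2 ?posrE// ler_nat; lia.
have N0 : 0 < (n.+1%:R : R) ^+ 10 by rewrite exprn_gt0.
rewrite -ltr_pdivrMl//; apply: le_lt_trans IHn; apply: le_trans h.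
rewrite ler_pM2r//; move: i20; set i := _^-1; lra.
Qed.

Lemma powR2D x y : 2 `^ (x + y) = 2 `^ x * 2 `^ y :> R.
Proof. by rewrite powRD// pnatr_eq0 implybT. Qed.

Lemma le_powR2 x y : x <= y -> 2 `^ x <= 2 `^ y :> R.
Proof. by move=> xy; rewrite ler_powR// ler1n. Qed.

Lemma powR2X x m : (2 `^ x) ^+ m = 2 `^ (x * m%:R) :> R.
Proof. by rewrite -powR_mulrn ?powR_ge0// powRrM. Qed.

Lemma powR2n m : 2 ^+ m = 2 `^ m%:R :> R.
Proof. by rewrite powR_mulrn. Qed.

Lemma natR_le_powR2 n : (64 <= n)%N -> (n%:R : R) <= 2 `^ (n%:R / 10).
Proof.
move=> n64; have n0 : 0 < (n%:R : R) by rewrite ltr0n; lia.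
rewrite -(@ler_pXn2r _ 10)// ?nnegrE ?powR_ge0 ?ler0n//.
by rewrite powR2X divfK// -powR2n ltW// exp10_lt_exp2.
Qed.

Lemma log2_lt n : (64 <= n)%N -> log2 (n%:R : R) < n%:R / 10.
Proof.
move=> n64; have n0 : 0 < (n%:R : R) by rewrite ltr0n; lia.
have := exp10_lt_exp2 n64; rewrite -ltr_ln ?posrE ?exprn_gt0// !lnXn//.
rewrite -![ln _ *+ _]mulr_natl /log2 => h.
by rewrite ltr_pdivrMr ?ln2_gt0// mulrAC ltr_pdivlMr// mulrC.
Qed.

Lemma fact_le_exp m : (m`! <= m ^ m)%N.
Proof.
elim: m => // m IHm; rewrite factS expnS leq_mul2l/=.
by apply: leq_trans IHm _; case: m => // m; rewrite leq_exp2r.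
Qed.

(** By [j! <= j^j] the left side is at most [2^(22m+2) m^(6m)], and [22m + 2 <= 24m] gives
    [(16m)^(6m)]. The factor [2^(7m)] is a reserve spent in [markov_numeric]. *)
Lemma khconst_prod_le m n : (0 < m)%N -> (16 * m <= n)%N ->
  4 ^+ m * khconst R m * khconst R (2 * m) * 2 ^+ (7 * m) <= n%:R ^+ (6 * m).
Proof.
move=> m0 mn; rewrite /khconst -!natrX -!natrM ler_nat.
apply: (@leq_trans ((16 * m) ^ (6 * m))); last by rewrite leq_exp2r//; lia.
apply: (@leq_trans (4 ^ m * (2 ^ m.+1 * (2 * m) ^ (2 * m)) *
    (2 ^ (2 * m).+1 * (4 * m) ^ (4 * m)) * 2 ^ (7 * m))).
  have h2 := fact_le_exp (2 * m); have h4 := fact_le_exp (4 * m).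
  rewrite leq_mul2r; apply/orP; right; apply: leq_mul; last first.
    by rewrite mulnA leq_mul2l h4 orbT.
  by rewrite leq_mul2l leq_mul2l h2 !orbT.
rewrite !expnMn.
have -> : (4 ^ m * (2 ^ m.+1 * (2 ^ (2 * m) * m ^ (2 * m))) *
    (2 ^ (2 * m).+1 * (4 ^ (4 * m) * m ^ (4 * m))) * 2 ^ (7 * m) =
  2 ^ (22 * m + 2) * m ^ (6 * m))%N.
  have -> : (4 ^ m = 2 ^ (2 * m))%N by rewrite expnM.
  have -> : (4 ^ (4 * m) = 2 ^ (8 * m))%N.
    by rewrite -[4%N]/(2 ^ 2)%N -expnM; congr (2 ^ _)%N; lia.
  have -> : (22 * m + 2 = 2 * m + m.+1 + 2 * m + (2 * m).+1 + 8 * m + 7 * m)%N by lia.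
  have -> : (6 * m = 2 * m + 4 * m)%N by lia.
  rewrite !expnD; nia.
rewrite leq_mul2r; apply/orP; right.
by rewrite -[16%N]/(2 ^ 4)%N -expnM leq_exp2l//; lia.
Qed.

Lemma haar_bound_le n m dS dE : (64 <= n)%N -> (2 ^ n = dS * dE)%N ->
  dS%:R <= 2 `^ (n%:R / 10) :> R -> (0 < m)%N -> (16 * m <= n)%N ->
  dS%:R ^+ (3 * m) * (4 ^+ m * offdiag_bound R dS dE m) <=
  2 `^ (- (7 * m%:R + n%:R / 5 * m%:R)).
Proof.
move=> n64 hd hS m0 mn.
have d0 : 0 < ((dS * dE)%:R : R) by rewrite -hd ltr0n expn_gt0.
have := khconst_prod_le m0 mn; set KK := 4 ^+ m * _ * _.
have KK0 : 0 <= KK by rewrite !mulr_ge0 ?exprn_ge0 ?khconst_ge0.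
rewrite -ler_pdivlMr ?exprn_gt0// => hK.
have alg (u v a b c : R) : u * v != 0 ->
    u ^+ 3 * (a * (b * (v * (c / (u * v) ^+ 2)))) = u ^+ 2 * (a * b * c) / (u * v).
  by rewrite mulf_eq0 negb_or => /andP[u0 v0]; field; rewrite u0 v0.
have -> : dS%:R ^+ (3 * m) * (4 ^+ m * offdiag_bound R dS dE m) =
    dS%:R ^+ (2 * m) * KK / (dS * dE)%:R ^+ m.
  rewrite /offdiag_bound /KK; move: (khconst _ _) (khconst _ _) (4 ^+ m) => b c a.
  have qE : (dS * dE)%:R ^+ m = dS%:R ^+ m * dE%:R ^+ m :> R by rewrite natrM exprMn.
  by rewrite !(mulnC _ m) !exprM qE alg// -qE expf_neq0// gt_eqF.
rewrite -hd natrX powR2n powR2X ler_pdivrMr ?powR_gt0// -powR2D.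
have S2 : dS%:R ^+ (2 * m) <= 2 `^ (n%:R / 10 * (2 * m)%:R) :> R.
  by rewrite -powR2X lerXn2r// nnegrE ?powR_ge0.
have K2 : KK <= 2 `^ (n%:R / 10 * (6 * m)%:R - (7 * m)%:R).
  apply: le_trans hK _; rewrite powR2D powRN -powR2n ler_pM2r ?invr_gt0 ?exprn_gt0//.
  by rewrite -powR2X lerXn2r ?nnegrE ?powR_ge0//; exact: natR_le_powR2.
apply: le_trans (ler_pM _ KK0 S2 K2) _; first by rewrite exprn_ge0.
rewrite -powR2D le_powR2// !natrM; lra.
Qed.

Lemma design_error_le n m k : (16 * m <= n)%N -> (64 <= n)%N ->
  ((2 ^ n)%:R ^+ 10) ^+ m * (4 ^- (n ^ 2)%N / (2 ^ n)%:R ^+ k) <=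
  2 `^ (- (7 * m%:R + n%:R / 5 * m%:R)) :> R.
Proof.
move=> mn n64.
have e4 : 4 ^- (n ^ 2)%N = 2 `^ (- (2 * (n * n)%:R)) :> R.
  rewrite powRN (_ : 4 = 2 ^+ 2 :> R); last by ring.
  by rewrite -exprM powR2n natrM.
have k1 : (4 : R) ^- (n ^ 2)%N / (2 ^ n)%:R ^+ k <= 4 ^- (n ^ 2)%N.
  rewrite ler_pdivrMr ?exprn_gt0 ?ltr0n ?expn_gt0// ler_peMr ?invr_ge0 ?exprn_ge0//.
  by rewrite exprn_ege1// ler1n expn_gt0.
apply: le_trans (ler_wpM2l _ k1) _; first by rewrite !exprn_ge0.
rewrite e4 natrX powR2n !powR2X -powR2D le_powR2//.
have mn' : 16 * (m%:R * n%:R) <= (n * n)%:R :> R by rewrite -!natrM ler_nat; nia.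
have n64' : 64 * m%:R <= m%:R * n%:R :> R by rewrite -!natrM ler_nat; nia.
have m0 : 0 <= m%:R :> R by [].
lra.
Qed.

(** [3/4 * 2^alpha] bounds [2^alpha - 1] from below since [alpha >= 2]. Weakening it to
    [2^(alpha-1)] costs [2^m], and adding the two error terms costs 2; the reserve [2^(-7m)] pays
    for both. *)
Lemma markov_numeric n m (K alpha P E e : R) : (0 < m)%N ->
  2 <= alpha -> K <= m%:R -> 0 <= P ->
  E <= 2 `^ (- (7 * m%:R + n%:R / 5 * m%:R)) ->
  e <= 2 `^ (- (7 * m%:R + n%:R / 5 * m%:R)) ->
  (3 / 4 * 2 `^ alpha) ^+ m * P <= E + e ->
  P <= 2 `^ (- (K * (n%:R / 5 + alpha))).
Proof.
move=> m0 a2 Km P0 hE he h.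
set B := 2 `^ _ in hE he.
have c0 : 0 < (2 `^ (alpha - 1)) ^+ m :> R by rewrite exprn_gt0// powR_gt0.
have {}h : (2 `^ (alpha - 1)) ^+ m * P <= 2 * B.
  apply: (@le_trans _ _ ((3 / 4 * 2 `^ alpha) ^+ m * P)); last by lra.
  rewrite ler_wpM2r// lerXn2r ?nnegrE ?mulr_ge0 ?powR_ge0//.
  rewrite powR2D powRN powRr1//; have := powR_ge0 2 alpha; lra.
rewrite -(ler_pM2l c0); apply: le_trans h _.
rewrite -{1}[2](powRr1 (ler0n R 2)) -powR2D powR2X -powR2D le_powR2//.
have n0 : 0 <= n%:R :> R by [].
have m1 : 1 <= m%:R :> R by rewrite ler1n.
have : K * (n%:R / 5 + alpha) <= m%:R * (n%:R / 5 + alpha) by rewrite ler_wpM2r//; lra.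
lra.
Qed.

End Numerics.

(** * From the entropy event to the tail bound *)

Lemma entropy_event_purity (R : realType) dS (A : 'M[R[i]]_dS) (alpha beta : R) :
  (0 < dS)%N -> 0 <= beta -> is_state A ->
  vn_entropy A <= log2 (dS%:R : R) - alpha - beta ->
  2 `^ alpha <= dS%:R * purity A.
Proof.
move=> dS0 b0 sA h; have p0 := purity_gt0 sA.
have dS0' : 0 < dS%:R :> R by rewrite ltr0n.
apply: powR2_log2; first exact: mulr_gt0.
have := le_trans (entropy_ge_purity sA) h.
by rewrite /log2 lnM ?posrE// mulrDl; lra.
Qed.

(** [log2 n < n/10] gives [K > 1], hence [k >= 2] and a usable moment [k./2 >= 1]. Halving with
    rounding is absorbed by [K <= 2 k./2 + 1 <= 8 k./2]; this 8 turns the 10 of the design order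
    into the 80 of the exponent. *)
Lemma moment_order (R : realType) n (K := n%:R / (10 * log2 (n%:R : R)))
    (k := `|Num.ceil K|%N) : (64 <= n)%N ->
  [/\ (0 < k./2)%N, (16 * k./2 <= n)%N & K / 8 <= k./2%:R].
Proof.
have half (j : nat) : (1 < j)%N -> (8 * j <= n)%N ->
    [/\ 0 < j./2, 16 * j./2 <= n & j <= (2 * j./2).+1]%N.
  by move=> j1 jn; split; lia.
move=> n64.
have l6 : 6 <= log2 (n%:R : R) by apply: (@log2_nat_ge R 6); rewrite (leq_trans _ n64).
have ln10 := log2_lt R n64.
have n64' : 64 <= n%:R :> R by rewrite ler_nat.
have l0 : 0 < 10 * log2 (n%:R : R) by lra.
have K1 : 1 < K by rewrite ltr_pdivlMr//; lra.
have K60 : K <= n%:R / 60.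
  by rewrite ler_pdivrMr// mulrAC ler_pdivlMr//; nra.
have kE : k%:R = (Num.ceil K)%:~R :> R.
  by rewrite /k natr_absz ger0_norm// ceil_ge0; lra.
have Kk : K <= k%:R by rewrite kE ceil_ge.
have kK : k%:R < K + 1.
  by rewrite kE; have /andP[+ _] := ceil_itv K; rewrite rmorphB/=; lra.
have k2 : (1 < k)%N by rewrite -(ltr_nat R); lra.
have kn : (8 * k <= n)%N by rewrite -(ler_nat R) natrM; lra.
have [m0 m16 km] := half k k2 kn; split=> //.
have : 1 <= k./2%:R :> R by rewrite ler1n.
move: km; rewrite -(ler_nat R) -natr1 natrM; lra.
Qed.

Theorem theorem1p3 (R : realType) (n dS dE : nat) (alpha : R)
  (H nu : probability (unitaryGroup R (dS * dE)) R)
  (rho0 : 'M[R[i]]_(dS * dE))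
  (hn : (19 <= n)%N)
  (hd : (2 ^ n = dS * dE)%N)
  (hdS2 : (2 <= dS)%N)
  (hdS : dS%:R <= 2 `^ (n%:R / 10) :> R)
  (halpha : 2 <= alpha)
  (hH : is_haar H)
  (hnu : approx_unitary_design H nu (4 ^- (n ^ 2)%N)
           `|Num.ceil (n%:R / (10 * log2 (n%:R : R)))|%N)
  (hrho0 : is_state rho0) :
  let beta : R := 1 / ln 2 * (dS%:R / dE%:R) in
  (nu [set U : unitaryGroup R (dS * dE) |
         (vn_entropy (ptraceE (conj_unitary U rho0))
            <= log2 (dS%:R : R) - alpha - beta)%R]
   <= (8 * 2 `^ (- (n%:R / (80 * log2 (n%:R : R))
                    * (n%:R / 5 + alpha))))%:E)%E.
Proof.
cbv zeta; set beta : R := 1 / ln 2 * (dS%:R / dE%:R).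
set A := [set U | _]; set rhs := 2 `^ _.
have dS0 : (0 < dS)%N by lia.
have beta0 : 0 <= beta.
  by rewrite /beta mulr_ge0 ?divr_ge0// ltW// ln2_gt0.
have sZ U := reduced_state hrho0 U.
have mA : measurable A.
  have mS := measurable_entropy (mxbm_reduced rho0) sZ.
  have := mS measurableT _ (measurable_itv `]-oo, (log2 dS%:R - alpha - beta)]).
  by rewrite setTI set_itvE.
have Apur U : A U -> 2 `^ alpha <= dS%:R * purity (reduced rho0 U).
  by move=> h; exact: entropy_event_purity dS0 beta0 (sZ U) h.
have rhs0 : 0 <= rhs by exact: powR_ge0.
have n19 : 19 <= n%:R :> R by rewrite ler_nat.
have [n63|n64] := leqP n 63.
  have l4 : 4 <= log2 (n%:R : R).
    by apply: (@log2_nat_ge R 4); apply: leq_trans hn.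
  have [an|na] := leP alpha (n%:R / 10).
    apply: le_trans (probability_le1 _ mA) _; rewrite lee_fin.
    (* This makes the bound [8 * rhs] at least 1. As [n/5 + alpha <= 3n/10], it suffices that
       [n^2 <= 800 log2 n]: [31^2 <= 3200] with [log2 n >= 4], and [63^2 = 3969 <= 4000] with
       [log2 n >= 5]. *)
    have : 2 `^ (-3) <= rhs.
      apply: le_powR2; rewrite lerN2 mulrAC ler_pdivrMr; last by lra.
      have [n31|n32] := leqP n 31.
        by move: n31; rewrite -(ler_nat R); nra.
      have l5 : 5 <= log2 (n%:R : R) by exact: (@log2_nat_ge R 5).
      by move: n63; rewrite -(ler_nat R); nra.
    by rewrite powRN -[3]/(3%:R) -powR2n; lra.
  (* The purity is at most 1, so the event would force [2^alpha <= dS <= 2^(n/10)]. *)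
  have -> : A = set0.
    apply/seteqP; split=> // U /Apur h.
    have p1 := purity_le1 (sZ U).
    have : 2 `^ alpha <= 2 `^ (n%:R / 10).
      apply: le_trans h (le_trans _ hdS).
      by rewrite ler_piMr.
    by rewrite -ler_ln ?posrE ?powR_gt0// !ln_powR ler_pM2r ?ln2_gt0// leNgt na.
  by rewrite measure0 lee_fin mulr_ge0.
have [m0 m16 Km] := moment_order R n64.
set k := `|_|%N in hnu m0 m16 Km; set m := k./2 in m0 m16 Km.
have d1 : (1 < dS * dE)%N by rewrite -hd -(expn0 2) ltn_exp2l//; lia.
have X0 U := excess_ge0 hrho0 U dS0.
have bX := bmfX m (bmf_excess rho0).
have := @Ex_markov _ _ R nu _ A ((3 / 4 * 2 `^ alpha) ^+ m) mA bX.
move=> /(_ (fun U => exprn_ge0 m (X0 U))) mk.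
have {}mk : (3 / 4 * 2 `^ alpha) ^+ m * fine (nu A) <=
    Ex nu (fun U => excess rho0 U ^+ m).
  apply: mk => U /Apur h.
  have a4 : 4 <= 2 `^ alpha.
    have := le_powR2 halpha; rewrite -[2 `^ 2]/(2 `^ 2%:R) -powR2n; lra.
  rewrite lerXn2r ?nnegrE ?mulr_ge0 ?powR_ge0//.
  by rewrite /excess; lra.
have km : (m * 2 <= k)%N by rewrite muln2 -[leqRHS]odd_double_half leq_addl.
have e0 : 0 <= 4 ^- (n ^ 2)%N :> R by rewrite invr_ge0 exprn_ge0.
have bp : bal (m * 2) (((dS * dE)%:R ^+ 10) ^+ m) (fun U => (excess rho0 U ^+ m)%:C).
  under [X in bal _ _ X]eq_fun do rewrite rmorphXn.
  exact: balX (bal_excess hrho0 d1).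
have := le_trans mk (design_real hnu km e0 bp).
have hE := le_trans (haar_excess_moment hH d1 hrho0 m0 dS0)
  (haar_bound_le n64 hd hdS m0 m16).
have he := design_error_le R k m16 n64; rewrite hd in he.
have P0 : 0 <= fine (nu A) by rewrite fine_ge0.
move=> /(markov_numeric m0 halpha Km P0 hE he) hP.
rewrite -(@fineK _ (nu A)) ?fin_num_measure// lee_fin.
have e80 : n%:R / (80 * log2 (n%:R : R)) = n%:R / (10 * log2 (n%:R : R)) / 8.
  by rewrite -mulrA -invfM mulrAC -natrM.
rewrite -e80 in hP; apply: le_trans hP _.
by rewrite -[leLHS]mul1r ler_wpM2r ?ler1n.
Qed.
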